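(* Let $(x^k)_{k\ge 0}$ be generated by the ARock algorithm for a nonexpansive operator $T:\mathbb{H}\to\mathbb{H}$ with at least one fixed point. Assume that the block sequence $i(0),i(1),\ldots$ is a sequence of IID random variables, uniform on $\{1,\ldots,m\}$, and that the delay vectors $\vec{j}(0),\vec{j}(1),\ldots$ are an evenly old, IID sequence that is independent of the block sequence. Let $P_l=\mathbb{P}[j(k)\ge l]$. Let the step size be $\eta^k=ch$ for an arbitrary fixed $c\in(0,1)$, with $h$ given below. Then the iterates of ARock converge weakly to a solution (a point of $\mathrm{Fix}(T)$) with probability $1$ if either of the following holds: 1. $\sum_{l=1}^{\infty}(lP_l)^{1/2}<\infty$, and $h=\left(1+\frac{1}{\sqrt{m}}\sum_{l=1}^{\infty}P_l^{1/2}\left(l^{1/2}+l^{-1/2}\right)\right)^{-1}$. 2. $\sum_{l=1}^{\infty}P_l^{1/2}\,l<\infty$, and $h=\left(1+\frac{2}{\sqrt{m}}\sum_{l=1}^{\infty}P_l^{1/2}\right)^{-1}$.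
   Context: $\mathbb{H}$ is a separable Hilbert space, decomposed into $m$ orthogonal subspaces $\mathbb{H}=\mathbb{H}_1\times\cdots\times\mathbb{H}_m$; write $x=(x_1,\ldots,x_m)$ with $x_i\in\mathbb{H}_i$. $T:\mathbb{H}\to\mathbb{H}$ is nonexpansive: $\|Tx-Ty\|\le\|x-y\|$. $\mathrm{Fix}(T)$ is its set of fixed points; a solution is an element of $\mathrm{Fix}(T)$. $S=I-T$, and $S_ix$ is the $i$-th block of $Sx$. $\mathbb{N}=\{0,1,2,\ldots\}$. ARock algorithm: given a starting point $x^0\in\mathbb{H}$, step lengths $\eta^0,\eta^1,\ldots$, block indices $i(k)\in\{1,\ldots,m\}$ and delay vectors $\vec{j}(k)=(j(k,1),\ldots,j(k,m))\in\mathbb{N}^m$, define for $k=0,1,2,\ldots$ and $i=1,\ldots,m$: $x_i^{k+1}=x_i^k-\eta^kS_i(\hat{x}^k)$ if $i=i(k)$, and $x_i^{k+1}=x_i^k$ if $i\ne i(k)$. The delayed iterate is $\hat{x}^k=x^{k-\vec{j}(k)}$, where $x^{k-\vec{j}}=(x_1^{k-j_1},\ldots,x_m^{k-j_m})$ and $x^n=x^0$ for $n<0$. The current delay is $j(k)=\max_{1\le i\le m}j(k,i)$. Delays are evenly old if there is a constant $B$ such that, with probability $1$, $|j(k,i)-j(k,l)|\le B$ for all $k\in\mathbb{N}$ and $1\le i,l\le m$. Since the delay vectors are IID, $P_l$ does not depend on $k$. *)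

(* Defs.v *)
From HB Require Import structures.
From mathcomp Require Export all_boot all_order all_algebra.
From mathcomp Require Export sesquilinear.
From mathcomp Require Export all_classical all_reals all_analysis.

Set Implicit Arguments.
Unset Strict Implicit.
Unset Printing Implicit Defensive.

Import Order.TTheory GRing.Theory Num.Theory.
Import numFieldNormedType.Exports.
Local Open Scope classical_set_scope.
Local Open Scope ring_scope.

HB.instance Definition _ (n : nat) := isPointed.Build 'I_n.+1 ord0.
HB.instance Definition _ (n : nat) :=
  @isMeasurable.Build default_measure_display 'I_n.+1 discrete_measurable
    discrete_measurable0 discrete_measurableC discrete_measurableU.

Definition separable_space (X : topologicalType) : Prop :=
  exists D : set X, countable D /\ dense D.

Section hilbert.
Context {R : realType} {H : completeNormedModType R}.

(* Completeness of H then makes it a real Hilbert space. *)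
Definition norm_of_dot (dot : {dot H for idfun}) : Prop :=
  forall x : H, `|x| ^+ 2 = dot x x.

(* H is the orthogonal direct sum of the subspaces E i; pr i x is the block
   x_i of x, seen as an element of H. The maps pr i are determined by E. *)
Definition orthogonal_blocks (dot : {dot H for idfun}) (m : nat)
    (E : 'I_m -> {pred H}) (pr : 'I_m -> H -> H) : Prop :=
  [/\ forall i, submod_closed (E i),
      forall i j, i != j -> {in E i & E j, forall x y, dot x y = 0},
      forall i x, pr i x \in E i
    & forall x, x = \sum_(i < m) pr i x].

Definition nonexpansive (T : H -> H) : Prop :=
  forall x y, `|T x - T y| <= `|x - y|.

Definition Fix (T : H -> H) : set H := [set x | T x = x].

Definition weak_cvg (dot : {dot H for idfun}) (u : nat -> H) (z : H) : Prop :=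
  forall y : H, dot (u n) y @[n --> \oo] --> dot z y.

End hilbert.

Section probability.
Context d {Omega : measurableType d} {R : realType} (P : probability Omega R).

Definition mutually_independent d' (U : measurableType d')
    (X : nat -> {RV P >-> U}) : Prop :=
  forall (s : seq nat) (A : nat -> set U),
    uniq s -> (forall k, measurable (A k)) ->
    P (\bigcap_(k in [set` s]) (X k @^-1` A k)) =
      (\prod_(k <- s) P (X k @^-1` A k))%E.

Definition iid d' (U : measurableType d') (X : nat -> {RV P >-> U}) : Prop :=
  mutually_independent X /\
  forall k (A : set U), measurable A ->
    distribution P (X k) A = distribution P (X 0%N) A.

Definition sigma_of_seq d' (U : measurableType d') (X : nat -> {RV P >-> U}) :
    set (set Omega) :=
  <<s \bigcup_k g_sigma_algebra_preimage (X k) >>.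

Definition independent_sequences d1 d2
    (U : measurableType d1) (V : measurableType d2)
    (X : nat -> {RV P >-> U}) (Y : nat -> {RV P >-> V}) : Prop :=
  forall A B : set Omega, sigma_of_seq X A -> sigma_of_seq Y B ->
    P (A `&` B) = (P A * P B)%E.

Definition uniform_block m (X : {RV P >-> 'I_m.+1}) : Prop :=
  forall i, P (X @^-1` [set i]) = (m.+1%:R^-1 : R)%:E.

Definition evenly_old m (J : nat -> {RV P >-> m.-tuple nat}) : Prop :=
  exists B : R, {ae P, forall w, forall k (i l : 'I_m),
    `|(tnth (J k w) i)%:R - (tnth (J k w) l)%:R| <= B}.

Definition current_delay m (j : m.-tuple nat) : nat :=
  (\max_(i < m) tnth j i)%N.

(* P [j(k) >= l]; for an identically distributed sequence J this does not
   depend on k, so the index 0 is used. *)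
Definition delay_tail m (J : nat -> {RV P >-> m.-tuple nat}) (l : nat) : R :=
  fine (P [set w | (l <= current_delay (J 0%N w))%N]).

End probability.

Section arock.
Context {R : realType} {H : completeNormedModType R} {m : nat}.
Variable pr : 'I_m -> H -> H.

(* Block i is taken from the iterate of index k - j_i. Subtraction on nat is
   truncated, which is the convention x^n = x^0 for n < 0. *)
Definition delayed_iterate (x : nat -> H) (k : nat) (j : m.-tuple nat) : H :=
  \sum_(i < m) pr i (x (k - tnth j i)%N).

Definition ARock (T : H -> H) (eta : nat -> R) (b : nat -> 'I_m)
    (j : nat -> m.-tuple nat) (x0 : H) (x : nat -> H) : Prop :=
  x 0%N = x0 /\
  forall k i,
    let xhat := delayed_iterate x k (j k) in
    pr i (x k.+1) =
      if i == b k then pr i (x k) - eta k *: pr i (xhat - T xhat)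
      else pr i (x k).

End arock.

Section conditions.
Context {R : realType}.
Implicit Type p : nat -> R.

Definition step_condition1 (m : nat) p (h : R) : Prop :=
  (\sum_(1 <= l <oo) (Num.sqrt (l%:R * p l))%:E < +oo)%E /\
  h = (1 + (Num.sqrt m%:R)^-1 *
        fine (\sum_(1 <= l <oo)
          (Num.sqrt (p l) * (Num.sqrt l%:R + (Num.sqrt l%:R)^-1))%:E)%E)^-1.

Definition step_condition2 (m : nat) p (h : R) : Prop :=
  (\sum_(1 <= l <oo) (Num.sqrt (p l) * l%:R)%:E < +oo)%E /\
  h = (1 + 2 / Num.sqrt m%:R *
        fine (\sum_(1 <= l <oo) (Num.sqrt (p l))%:E)%E)^-1.

End conditions.

(* Main.v *)
(* For a fixed point p, the distance |x^k - p|^2 is corrected by a weighted sum of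
   the past increments, lyapunov_k = |x^k - p|^2 + sum_l c_l |x^(k-l) - x^(k-l-1)|^2.
   Since the block i(k) and the delays j(k) are independent of the past, averaging
   over them gives
     E[lyapunov_(k+1) | past] + E[drift_k | past] <= lyapunov_k,
     drift_k = d1 |S xhat^k|^2 + d2 |xhat^k - x^k|^2.
   The weights c_l absorb the delay error: E[1_{j(k) > l}] is P_(l+1) whatever the
   past, and the step-size condition is exactly what makes d1 positive.  Hence, for
   every fixed p, almost surely lyapunov_k converges (upcrossings) and drift_k is
   summable.  So S x^k -> 0 and the increments are square summable, which makes the
   correction term, and then |x^k - p|, converge; separability makes this hold for
   all fixed points p simultaneously.  Weak convergence follows as in Opial's lemma.

   No conditional expectation is needed: delays beyond k act as k at step k, so
   (x^0, ..., x^k) takes finitely many values and averages are finite sums. *)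
Require Import Defs.
From mathcomp Require Import ring lra measurable_realfun.

Set Implicit Arguments.
Unset Strict Implicit.
Unset Printing Implicit Defensive.

Import Order.TTheory GRing.Theory Num.Theory.
Import numFieldNormedType.Exports.
Local Open Scope classical_set_scope.
Local Open Scope ring_scope.

(** * Weak convergence in Hilbert space *)

Section inner_product.
Context {R : realType} {H : completeNormedModType R}.
Variable dot : {dot H for idfun}.
Hypothesis dot_norm : norm_of_dot dot.
Implicit Types x y z : H.

Lemma dotC x y : dot x y = dot y x.
Proof. by have := hermC dot x y; rewrite expr0 mul1r. Qed.

Lemma dotDl x y z : dot (x + y) z = dot x z + dot y z.
Proof. exact: (linearDl dot). Qed.

Lemma dotBl x y z : dot (x - y) z = dot x z - dot y z.
Proof. exact: (linearBl dot). Qed.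

Lemma dotZl a x z : dot (a *: x) z = a * dot x z.
Proof. exact: (linearZl_LR dot). Qed.

Lemma dotDr x y z : dot z (x + y) = dot z x + dot z y.
Proof. exact: (linearDr dot). Qed.

Lemma dotBr x y z : dot z (x - y) = dot z x - dot z y.
Proof. exact: (linearBr dot). Qed.

Lemma dotZr a x z : dot z (a *: x) = a * dot z x.
Proof. by rewrite dotC dotZl dotC. Qed.

Lemma sqr_normD x y : `|x + y| ^+ 2 = `|x| ^+ 2 + 2 * dot x y + `|y| ^+ 2.
Proof. by rewrite !dot_norm !(dotDl, dotDr) (dotC y x); ring. Qed.

Lemma sqr_normB x y : `|x - y| ^+ 2 = `|x| ^+ 2 - 2 * dot x y + `|y| ^+ 2.
Proof. by rewrite !dot_norm !(dotBl, dotBr) (dotC y x); ring. Qed.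

Lemma dot_le_norm x y : dot x y <= `|x| * `|y|.
Proof.
have : `|x + y| ^+ 2 <= (`|x| + `|y|) ^+ 2 by rewrite lerXn2r ?nnegrE ?addr_ge0// ler_normD.
by rewrite sqr_normD; nra.
Qed.

Lemma parallelogram_midpoint x y z :
  `|z - 2^-1 *: (x + y)| ^+ 2 + 4^-1 * `|x - y| ^+ 2 =
  2^-1 * `|z - x| ^+ 2 + 2^-1 * `|z - y| ^+ 2.
Proof.
rewrite !dot_norm !(dotBl, dotBr, dotDl, dotDr, dotZl, dotZr).
by rewrite (dotC y x) (dotC x z) (dotC y z); lra.
Qed.

End inner_product.

Section asymptotic_center.
Context {R : realType} {H : completeNormedModType R}.
Variable dot : {dot H for idfun}.
Hypothesis dot_norm : norm_of_dot dot.
Variables (u : nat -> H) (F : set_system nat).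
Hypothesis F_proper : ProperFilter F.

(** The limit superior of the squared distance to [y] along [F], encoded as the infimum of the
    eventual upper bounds so that it serves any proper filter. Squares are kept for the sake of the
    parallelogram law. *)
Definition asym_radius (y : H) : R :=
  inf [set r | \forall n \near F, `|u n - y| ^+ 2 <= r].

Lemma asym_radius_lbound y :
  has_lbound [set r | \forall n \near F, `|u n - y| ^+ 2 <= r].
Proof.
exists 0 => r /= /filter_ex[n]; apply: le_trans; exact: sqr_ge0.
Qed.

Lemma asym_radius_le y r :
  (\forall n \near F, `|u n - y| ^+ 2 <= r) -> asym_radius y <= r.
Proof. by move=> h; apply: ge_inf => //; exact: asym_radius_lbound. Qed.

Hypothesis u_bounded : exists C, \forall n \near F, `|u n| <= C.

Lemma asym_radius_neq0 y :
  [set r | \forall n \near F, `|u n - y| ^+ 2 <= r] !=set0.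
Proof.
have [C uC] := u_bounded; exists ((C + `|y|) ^+ 2); near=> n.
have uCn : `|u n| <= C by near: n.
apply: lerXn2r; rewrite ?nnegrE//.
  by rewrite addr_ge0// (le_trans _ uCn).
by rewrite (le_trans (ler_normB _ _))// lerD2r.
Unshelve. all: end_near. Qed.

Lemma asym_radius_near y e :
  0 < e -> \forall n \near F, `|u n - y| ^+ 2 <= asym_radius y + e.
Proof.
move=> e0; have [] := @inf_adherent _ _ _ e0
  (conj (asym_radius_neq0 y) (asym_radius_lbound y)).
move=> r /= ur rlt; near=> n; apply: le_trans (ltW rlt); near: n; exact: ur.
Unshelve. all: end_near. Qed.

Lemma asym_radius_ge0 y : 0 <= asym_radius y.
Proof.
apply: lb_le_inf; first exact: asym_radius_neq0.
by move=> r /= /filter_ex[n]; apply: le_trans; exact: sqr_ge0.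
Qed.

(** With [a] the distance to [z] and [r] its radius, a^2 <= r + e with e <= 1 gives a <= r + 2, and
    expanding (a + e)^2 yields the factor 2 r + 6. *)
Lemma asym_radius_lipschitz y z e : 0 < e -> e <= 1 ->
  (\forall n \near F, `|u n - y| <= `|u n - z| + e) ->
  asym_radius y <= asym_radius z + e * (2 * asym_radius z + 6).
Proof.
move=> e0 e1 uyz; apply: asym_radius_le; near=> n.
have uz : `|u n - z| ^+ 2 <= asym_radius z + e.
  by near: n; exact: asym_radius_near.
have uyzn : `|u n - y| <= `|u n - z| + e by near: n.
have : `|u n - y| ^+ 2 <= (`|u n - z| + e) ^+ 2.
  by rewrite lerXn2r ?nnegrE// addr_ge0// ltW.
have := asym_radius_ge0 z; move: uz; rewrite !expr2.
set a := `|u n - z|; set b := `|u n - y|; set r := asym_radius z => h1 h2 h3.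
have h4 : a <= r + 2 by nra.
have : 0 <= a by exact: normr_ge0.
nra.
Unshelve. all: end_near. Qed.

Lemma asym_radius_nonincr y z :
  (forall e, 0 < e -> \forall n \near F, `|u n - y| <= `|u n - z| + e) ->
  asym_radius y <= asym_radius z.
Proof.
move=> uyz; apply/ler_addgt0Pr => e e0.
pose K := 2 * asym_radius z + 6.
have K0 : 0 < K by rewrite /K; have := asym_radius_ge0 z; lra.
pose e' := Num.min 1 (e / K).
have e'0 : 0 < e' by rewrite /e' lt_min ltr01 divr_gt0.
apply: (le_trans (asym_radius_lipschitz e'0 _ (uyz _ e'0))).
  by rewrite /e' ge_min lexx.
by rewrite lerD2l -ler_pdivlMr// /e' ge_min lexx orbT.
Qed.

Lemma asym_radius_midpoint x y :
  asym_radius (2^-1 *: (x + y)) + 4^-1 * `|x - y| ^+ 2 <=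
  2^-1 * asym_radius x + 2^-1 * asym_radius y.
Proof.
apply/ler_addgt0Pr => e e0; rewrite -lerBrDr; apply: asym_radius_le; near=> n.
have ux : `|u n - x| ^+ 2 <= asym_radius x + e by near: n; exact: asym_radius_near.
have uy : `|u n - y| ^+ 2 <= asym_radius y + e by near: n; exact: asym_radius_near.
have := parallelogram_midpoint dot_norm x y (u n); lra.
Unshelve. all: end_near. Qed.

(** A midpoint has radius at least the infimum [m], so the midpoint inequality bounds the squared
    distance of two points by twice their excesses over [m]. Minimizing sequences are therefore
    Cauchy, and the same bound at the limit gives the quadratic growth with factor 1/2. *)
Lemma asym_center :
  exists z, forall y, asym_radius z + 2^-1 * `|z - y| ^+ 2 <= asym_radius y.
Proof.
pose m := inf (range asym_radius).
have lbm : has_lbound (range asym_radius).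
  by exists 0 => _ [y _ <-]; exact: asym_radius_ge0.
have m_le y : m <= asym_radius y by apply: ge_inf => //; exists y.
have m0 : 0 <= m.
  rewrite /m; apply: lb_le_inf; first by exists (asym_radius 0), 0.
  by move=> _ [y _ <-]; exact: asym_radius_ge0.
have sq_dist x y : `|x - y| ^+ 2 <= 2 * (asym_radius x - m) + 2 * (asym_radius y - m).
  have := asym_radius_midpoint x y; have := m_le (2^-1 *: (x + y)); lra.
have approx n : exists y, asym_radius y < m + n.+1%:R^-1.
  have n0 : 0 < n.+1%:R^-1 :> R by rewrite invr_gt0.
  have has_inf_r : has_inf (range asym_radius).
    by split=> //; exists (asym_radius 0), 0.
  by have [_ [y _ <-] ?] := inf_adherent n0 has_inf_r; exists y.
have [v vm] := choice approx.
have v_cvg : cvgn v.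
  apply: cauchy_cvg; apply/cauchyP => e e0.
  have e2 : 0 < e ^+ 2 / 8 by rewrite divr_gt0// exprn_gt0.
  near \oo => N; exists (v N).
  suff : \forall n \near \oo, ball (v N) e (v n) by [].
  near=> n; rewrite -ball_normE /=.
  have smallN : N.+1%:R^-1 < e ^+ 2 / 8.
    by near: N; exact: (near_infty_natSinv_lt (PosNum e2)).
  have smalln : n.+1%:R^-1 < e ^+ 2 / 8.
    by near: n; exact: (near_infty_natSinv_lt (PosNum e2)).
  have := sq_dist (v N) (v n); have := vm N; have := vm n => hn hN hd.
  rewrite -(@ltr_pXn2r _ 2)// ?nnegrE ?(ltW e0)// (le_lt_trans hd)//.
  have := exprn_gt0 2 e0.
  by set a := n.+1%:R^-1 in hn smalln *; set b := N.+1%:R^-1 in hN smallN *; lra.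
pose z := lim (v @ \oo).
have rz : asym_radius z <= m.
  apply/ler_addgt0Pr => e e0.
  pose K := 2 * m + 8.
  have K0 : 0 < K by rewrite /K; lra.
  pose e' := Num.min 1 (e / 2 / K).
  have e'0 : 0 < e' by rewrite /e' lt_min ltr01 !divr_gt0.
  have e'1 : e' <= 1 by rewrite /e' ge_min lexx.
  have e2 : 0 < e / 2 by rewrite divr_gt0.
  near \oo => n.
  have dn : `|v n - z| <= e'.
    rewrite distrC; near: n; move/cvgrPdist_le : v_cvg; exact.
  have smalln : n.+1%:R^-1 < e / 2.
    by near: n; exact: (near_infty_natSinv_lt (PosNum e2)).
  have n1 : n.+1%:R^-1 <= 1 :> R by rewrite invf_le1// ler1n.
  have := @asym_radius_lipschitz z (v n) _ e'0 e'1.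
  have Hn : \forall k \near F, `|u k - z| <= `|u k - v n| + e'.
    near=> k; rewrite (le_trans (ler_distD (v n) _ _))// lerD2l//.
  move=> /(_ Hn) /le_trans; apply.
  have h1 := vm n; have h2 := m_le (v n).
  have h3 : e' * (2 * asym_radius (v n) + 6) <= e / 2.
    rewrite (@le_trans _ _ (e' * K))//.
      rewrite ler_pM2l// /K; move: h1 n1; set a := n.+1%:R^-1; lra.
    by rewrite -ler_pdivlMr// /e' ge_min lexx orbT.
  move: h1 smalln; set a := n.+1%:R^-1; lra.
exists z => y; have := sq_dist z y; have := m_le z; have := m_le y; lra.
Unshelve. all: end_near. Qed.

End asymptotic_center.

Section weak_convergence.
Context {R : realType} {H : completeNormedModType R}.
Variable dot : {dot H for idfun}.
Hypothesis dot_norm : norm_of_dot dot.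

Lemma asym_radius_cvg (u : nat -> H) (F : set_system nat) p l :
  ProperFilter F -> (exists C, \forall n \near F, `|u n| <= C) ->
  `|u n - p| ^+ 2 @[n --> F] --> l -> asym_radius u F p = l.
Proof.
move=> FF uC /cvgrPdist_le ul; apply/eqP; rewrite eq_le; apply/andP; split.
  apply/ler_addgt0Pr => e e0; apply: asym_radius_le; near=> n.
  have : `|l - `|u n - p| ^+ 2| <= e by near: n; exact: ul.
  by rewrite distrC ler_distl => /andP[].
apply/ler_addgt0Pr => e e0; rewrite -lerBlDr.
apply: lb_le_inf; first exact: asym_radius_neq0.
move=> r /= ur; near F => n.
have urn : `|u n - p| ^+ 2 <= r by near: n; exact: ur.
have : `|l - `|u n - p| ^+ 2| <= e by near: n; exact: ul.
by rewrite ler_distl => /andP[_ h]; rewrite lerBlDr (le_trans h)// lerD2r.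
Unshelve. all: end_near. Qed.

Variable T : H -> H.
Hypothesis T_nonexpansive : nonexpansive T.

(** Since [u n] is asymptotically [T (u n)], nonexpansiveness shows that [T z] has radius at most
    that of [z]; quadratic growth at the center then forces [T z = z]. This takes the place of the
    demiclosedness principle. *)
Lemma asym_center_fix (u : nat -> H) (F : set_system nat) :
  ProperFilter F -> (exists C, \forall n \near F, `|u n| <= C) ->
  u n - T (u n) @[n --> F] --> 0 ->
  exists2 z, Fix T z & forall y,
    asym_radius u F z + 2^-1 * `|z - y| ^+ 2 <= asym_radius u F y.
Proof.
move=> FF uC /cvgrPdist_le uT.
have [z zmin] := asym_center dot_norm FF uC; exists z => //.
have rT : asym_radius u F (T z) <= asym_radius u F z.
  apply: asym_radius_nonincr => // e e0; near=> n.
  have un : `|0 - (u n - T (u n))| <= e by near: n; exact: uT.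
  rewrite [leRHS]addrC (le_trans (ler_distD (T (u n)) _ _))// lerD//.
  by rewrite -normrN -sub0r.
have := zmin (T z); have : 0 <= `|z - T z| ^+ 2 by exact: sqr_ge0.
rewrite /Fix /= => h1 h2; apply/esym/eqP; rewrite -subr_eq0 -normr_eq0.
by rewrite -sqrf_eq0; apply/eqP; lra.
Unshelve. all: end_near. Qed.

(* The asymptotic center of every subsequence is a fixed point and, the limits
   of [`|u n - p|] being the same along every subsequence, all these centers
   coincide. *)
Lemma fejer_weak_cvg (u : nat -> H) :
  Fix T !=set0 ->
  u n - T (u n) @[n --> \oo] --> 0 ->
  (forall p, Fix T p -> cvgn (fun n => `|u n - p| ^+ 2)) ->
  exists2 z, Fix T z & weak_cvg dot u z.
Proof.
move=> [p0 Tp0] uT ucvg.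
have ubd (F : set_system nat) : ProperFilter F -> F --> \oo ->
    exists C, \forall n \near F, `|u n| <= C.
  move=> FF Foo; pose l := lim (`|u n - p0| ^+ 2 @[n --> \oo]).
  exists (l + 2 + `|p0|); apply: Foo; near=> n.
  have : `|l - `|u n - p0| ^+ 2| <= 1.
    by near: n; move/cvgrPdist_le : (ucvg _ Tp0); exact.
  rewrite distrC ler_distl => /andP[_ h1].
  have -> : u n = (u n - p0) + p0 by rewrite subrK.
  rewrite (le_trans (ler_normD _ _))// lerD2r.
  by move: h1; have := normr_ge0 (u n - p0); rewrite expr2; nra.
have [z Tz zmin] := asym_center_fix _ (ubd _ _ (fun _ => id)) uT.
have same_radius (F : set_system nat) p : ProperFilter F -> F --> \oo -> Fix T p ->
    asym_radius u F p = asym_radius u \oo p.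
  move=> FF Foo Tp.
  rewrite (asym_radius_cvg _ (ubd _ _ (fun _ => id)) (ucvg _ Tp)).
  apply: asym_radius_cvg => //; first exact: ubd.
  exact: cvg_trans (cvg_app _ Foo) (ucvg _ Tp).
have dot_lt y e : 0 < e -> \forall n \near \oo, dot (u n - z) y < e.
  move=> e0; apply: contrapT => nlt.
  pose D := [set n | e <= dot (u n - z) y].
  (* The trace of the filter at infinity on the bad set [D] plays the role of a subsequence; it is
     proper because [D] is not eventually avoided. *)
  pose F := within D \oo.
  have FF : ProperFilter F.
    apply: Build_ProperFilter_ex => // P FP; apply: contrapT => nP; apply: nlt.
    near=> n; rewrite ltNge; apply/negP => Dn; apply: nP; exists n.
    by move: Dn; near: n; exact: FP.
  have Foo : F --> \oo by exact: cvg_within.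
  have [z' Tz' z'min] := asym_center_fix FF (ubd _ FF Foo) (cvg_trans (cvg_app _ Foo) uT).
  (* The two centers are fixed points, whose radii agree along [F] and along the whole sequence;
     each minimizes against the other, so their distance is zero. *)
  have ezz' : z' = z.
    have := z'min z; rewrite !same_radius//.
    have := zmin z'; have := sqr_ge0 `|z - z'|; have := sqr_ge0 `|z' - z| => h1 h2 h3 h4.
    by apply/eqP; rewrite -subr_eq0 -normr_eq0 -sqrf_eq0; apply/eqP; lra.
  (* On [D], moving from [z] to [z + t *: y] changes the squared distance by at most - 2 t e + t^2
     |y|^2. This [t] keeps the quadratic term below t e, so the radius drops, against the minimality
     of [z]. *)
  pose t := e / (`|y| ^+ 2 + 1).
  have y0 : 0 < `|y| ^+ 2 + 1 by rewrite ltr_wpDl// sqr_ge0.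
  have t0 : 0 < t by rewrite divr_gt0.
  have te : t * (`|y| ^+ 2 + 1) = e by rewrite /t divfK ?gt_eqF.
  suff : asym_radius u F (z + t *: y) <= asym_radius u F z - t * e.
    have := z'min (z + t *: y); rewrite ezz'.
    have := sqr_ge0 `|z - (z + t *: y)|; have : 0 < t * e by rewrite mulr_gt0.
    lra.
  apply/ler_addgt0Pr => d d0; apply: asym_radius_le; near=> n.
  have un : `|u n - z| ^+ 2 <= asym_radius u F z + d.
    by near: n; apply: asym_radius_near => //; exact: ubd.
  have Dn : e <= dot (u n - z) y by near: n; exact: near_withinT.
  rewrite opprD addrA (sqr_normB dot_norm) (dotZr dot) normrZ exprMn.
  rewrite (ger0_norm (ltW t0)).
  have : t * e <= t * dot (u n - z) y by rewrite ler_pM2l.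
  have : t ^+ 2 * `|y| ^+ 2 <= t * e.
    by rewrite -te; have := sqr_ge0 t; lra.
  lra.
exists z => // y; apply/cvgrPdist_lt => e e0; near=> n.
rewrite -(dotBl dot) ltr_norml; apply/andP; split.
  rewrite ltrNl -(linearNl dot) opprB.
  by near: n; exact: dot_lt.
rewrite -opprB (linearNl dot) -(linearNr dot).
by near: n; exact: dot_lt.
Unshelve. all: end_near. Qed.

End weak_convergence.

(** * The conditional descent of the Lyapunov function *)

Section blocks.
Context {R : realType} {H : completeNormedModType R} {m : nat}.
Variable dot : {dot H for idfun}.
Hypothesis dot_norm : norm_of_dot dot.
Variables (E : 'I_m -> {pred H}) (pr : 'I_m -> H -> H).
Hypothesis H_blocks : orthogonal_blocks dot E pr.

Lemma dot_pr_neq i j x y : i != j -> dot (pr i x) (pr j y) = 0.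
Proof. by case: H_blocks => _ ort prE _ ij; exact: ort (prE _ _) (prE _ _). Qed.

Lemma sum_pr x : \sum_(i < m) pr i x = x.
Proof. by case: H_blocks => _ _ _ <-. Qed.

Lemma dot_prE i x y : dot (pr i x) y = dot (pr i x) (pr i y).
Proof.
rewrite -{1}(sum_pr y) (linear_sumr dot) (bigD1 i)//= big1 ?addr0// => j ji.
by rewrite dot_pr_neq// eq_sym.
Qed.

(** The differences of two decompositions sum to zero, and pairing this sum with its [i]-th term
    leaves only the square of that term. Additivity of [pr], which [orthogonal_blocks] does not
    state, follows from this. *)
Lemma pr_unique (a : 'I_m -> H) x :
  (forall i, a i \in E i) -> \sum_(i < m) a i = x -> forall i, pr i x = a i.
Proof.
case: H_blocks => subE ort prE _ aE ax i; apply/eqP; rewrite -subr_eq0.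
have dE j : pr j x - a j \in E j.
  have [_ Eadd_j] := subE j; rewrite addrC -scaleN1r.
  exact: Eadd_j (aE j) (prE j x).
have : \sum_(j < m) (pr j x - a j) = 0.
  by rewrite sumrB sum_pr ax subrr.
rewrite (bigD1 i)//= => /(congr1 (dot (pr i x - a i))).
rewrite (dotDr dot) (linear_sumr dot) (linear0r dot) [X in _ + X]big1 ?addr0.
  by move=> d0; rewrite -normr_eq0 -sqrf_eq0 dot_norm d0.
by move=> j ji; apply: (ort i j) (dE i) (dE j); rewrite eq_sym.
Qed.

Lemma prB i x y : pr i (x - y) = pr i x - pr i y.
Proof.
apply: (@pr_unique (fun i => pr i x - pr i y)) => [j|].
  case: H_blocks => subE _ prE _; have [_ Eadd] := subE j.
  by rewrite addrC -scaleN1r; exact: Eadd (prE _ _) (prE _ _).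
by rewrite sumrB !sum_pr.
Qed.

Lemma sum_dot_pr x y : \sum_(i < m) dot (pr i x) y = dot x y.
Proof. by rewrite -(linear_sumlz dot) sum_pr. Qed.

Lemma sqr_norm_sum_pr (A : pred 'I_m) (x : H) :
  `|\sum_(i < m | A i) pr i x| ^+ 2 = \sum_(i < m | A i) `|pr i x| ^+ 2.
Proof.
rewrite dot_norm (linear_sumlz dot); apply: eq_bigr => i Ai.
rewrite dot_norm (linear_sumr dot) (bigD1 i)//= big1 ?addr0// => j /andP[_ ji].
by rewrite dot_pr_neq// eq_sym.
Qed.

Lemma sqr_norm_pr x : \sum_(i < m) `|pr i x| ^+ 2 = `|x| ^+ 2.
Proof. by rewrite -(sqr_norm_sum_pr xpredT) sum_pr. Qed.

Lemma norm_sum_pr_le (A : pred 'I_m) x : `|\sum_(i < m | A i) pr i x| <= `|x|.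
Proof.
rewrite -(@ler_pXn2r _ 2) ?nnegrE// sqr_norm_sum_pr -sqr_norm_pr.
by rewrite (bigID A xpredT)/= lerDl sumr_ge0// => i _; exact: sqr_ge0.
Qed.

(** Here [v l] stands for the iterate [l] steps back. *)
Definition delay_error (v : nat -> H) (t : m.-tuple nat) : H :=
  \sum_(i < m) pr i (v (tnth t i)) - v 0%N.

Lemma leq_current_delay (t : m.-tuple nat) i : (tnth t i <= current_delay t)%N.
Proof. exact: leq_bigmax. Qed.

(** Telescope each block over its own delay, then exchange the sums. At lag [l] only the blocks
    delayed by more than [l] remain, and by orthogonality a partial sum of blocks is no longer than
    the full increment, so no factor depending on [m] appears. *)
Lemma delay_error_le (v : nat -> H) (t : m.-tuple nat) n :
  (current_delay t <= n)%N ->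
  `|delay_error v t| <=
    \sum_(l < n | (l < current_delay t)%N) `|v l - v l.+1|.
Proof.
move=> tn.
have -> : delay_error v t = \sum_(l < n)
    \sum_(i < m | (l < tnth t i)%N) pr i (v l.+1 - v l).
  rewrite (exchange_big_dep xpredT)//= /delay_error -(sum_pr (v 0%N)) -sumrB.
  apply: eq_bigr => i _; rewrite -prB.
  rewrite -(big_ord_widen n (fun l => pr i (v l.+1 - v l))); last first.
    exact: leq_trans (leq_current_delay t i) tn.
  elim: (tnth t i) => [|k IH]; first by rewrite big_ord0 prB subrr.
  by rewrite big_ord_recr/= -IH !prB [RHS]addrC addrA subrK.
rewrite [in leRHS]big_mkcond /= (le_trans (ler_norm_sum _ _ _))//.
apply: ler_sum => l _; case: ltnP => lt.
  by rewrite (le_trans (norm_sum_pr_le _ _))// distrC.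
rewrite big1 ?normr0// => i ltl.
by have := leq_trans ltl (leq_current_delay t i); rewrite ltnNge lt.
Qed.

Variable T : H -> H.
Hypothesis T_nonexpansive : nonexpansive T.

(** Cocoercivity of I - T relative to a fixed point: expand |(x - p) - (x - T x)|^2 <= |x - p|^2. *)
Lemma dot_residual_ge p x : Fix T p ->
  2^-1 * `|x - T x| ^+ 2 <= dot (x - T x) (x - p).
Proof.
move=> Tp; have : `|T x - p| ^+ 2 <= `|x - p| ^+ 2.
  by rewrite lerXn2r ?nnegrE// -[in leLHS]Tp; exact: T_nonexpansive.
have -> : T x - p = (x - p) - (x - T x) by rewrite opprB [RHS]addrC addrA subrK.
by rewrite (sqr_normB dot_norm (x - p)) (dotC dot (x - p)); lra.
Qed.

Lemma sum_sqr_norm_block_step eta (s x p : H) :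
  \sum_(i < m) `|x - eta *: pr i s - p| ^+ 2 =
  m%:R * `|x - p| ^+ 2 - 2 * eta * dot s (x - p) + eta ^+ 2 * `|s| ^+ 2.
Proof.
rewrite -(sum_dot_pr s) -(sqr_norm_pr s) !mulr_sumr -addrA.
have -> : m%:R * `|x - p| ^+ 2 = \sum_(i < m) `|x - p| ^+ 2.
  by rewrite sumr_const card_ord mulr_natl.
rewrite -sumrN -!big_split; apply: eq_bigr => i _ /=.
rewrite addrAC (sqr_normB dot_norm (x - p)) normrZ exprMn (dotZr dot) (dotC dot (x - p)).
by rewrite real_normK ?num_real//; ring.
Qed.

End blocks.

Section lyapunov.
Context {R : realType} {H : completeNormedModType R} {m : nat}.
Variable dot : {dot H for idfun}.
Hypothesis dot_norm : norm_of_dot dot.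
Variables (E : 'I_m -> {pred H}) (pr : 'I_m -> H -> H).
Hypothesis H_blocks : orthogonal_blocks dot E pr.
Variable T : H -> H.
Hypothesis T_nonexpansive : nonexpansive T.
Variables (x0 : H) (eta : R).

(* The state after k steps is the list [x^k; ...; x^0] of all iterates, latest
   first; [nth x0] extends it by [x^n = x^0] for [n < 0]. *)
Definition delayed_state (y : seq H) (t : m.-tuple nat) : H :=
  \sum_(i < m) pr i (nth x0 y (tnth t i)).

Definition delayed_residual (y : seq H) (t : m.-tuple nat) : H :=
  delayed_state y t - T (delayed_state y t).

Definition arock_step (y : seq H) (i : 'I_m) (t : m.-tuple nat) : seq H :=
  (nth x0 y 0 - eta *: pr i (delayed_residual y t)) :: y.

(** The last summand compares the oldest entry with the default [x0]; it vanishes when that entry is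
    x^0. *)
Definition lyapunov (c : nat -> R) (p : H) (y : seq H) : R :=
  `|nth x0 y 0 - p| ^+ 2 +
  \sum_(l < size y) c l * `|nth x0 y l - nth x0 y l.+1| ^+ 2.

(** [e] holds one Young weight per lag, [b] bounds their total, and [q l] will bound the probability
    of a delay above [l]. [residual_budget] makes the coefficient of the squared residual
    nonpositive; [c_decr] lets the drop in weight as a gap ages pay for the delay error. *)
Variables (c e q : nat -> R) (b d1 d2 : R) (p : H).
Hypothesis eta_ge0 : 0 <= eta.
Hypothesis e_gt0 : forall l, 0 < e l.
Hypothesis b_gt0 : 0 < b.
Hypothesis sum_e_le : forall n, \sum_(l < n) e l <= b.
Hypothesis d2_ge0 : 0 <= d2.
Hypothesis m_gt0 : (0 < m)%N.
Hypothesis residual_budget :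
  m%:R * d1 + eta ^+ 2 * (1 + c 0%N) + eta * b <= eta.
Hypothesis c_decr : forall l,
  c l.+1 + (eta / m%:R + d2 * b) * (q l / e l) <= c l.
Hypothesis Tp : Fix T p.

Let weighted_gaps (y : seq H) (t : m.-tuple nat) : R :=
  \sum_(l < size y | (l < current_delay t)%N)
    `|nth x0 y l - nth x0 y l.+1| ^+ 2 / e l.

(** Young's inequality 2 a g <= a^2 e + g^2 / e at each lag, summed over the lags below the
    delay. *)
Let weighted_gaps_ge y t (a : R) : (current_delay t <= size y)%N -> 0 <= a ->
  2 * a * `|delayed_state y t - nth x0 y 0| <= a ^+ 2 * b + weighted_gaps y t.
Proof.
move=> ty a0; apply: (@le_trans _ _ (2 * a *
    \sum_(l < size y | (l < current_delay t)%N) `|nth x0 y l - nth x0 y l.+1|)).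
  rewrite ler_wpM2l ?mulr_ge0//.
  exact: (delay_error_le dot_norm H_blocks (nth x0 y)).
apply: (@le_trans _ _ (a ^+ 2 * (\sum_(l < size y | (l < current_delay t)%N) e l)
    + weighted_gaps y t)).
  rewrite !mulr_sumr -big_split; apply: ler_sum => l _ /=.
  set g := `|_|; rewrite -subr_ge0.
  have el0 := e_gt0 l.
  suff -> : a ^+ 2 * e l + g ^+ 2 / e l - 2 * a * g = (a * e l - g) ^+ 2 / e l.
    by rewrite divr_ge0 ?sqr_ge0 ?ltW.
  by field; rewrite gt_eqF.
rewrite lerD2r ler_wpM2l ?sqr_ge0// (le_trans _ (sum_e_le (size y)))//.
by rewrite [leRHS](bigID (fun l : 'I_(size y) => l < current_delay t)%N)/= lerDl
  sumr_ge0// => l _; exact: ltW.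
Qed.

Let sum_block_lyapunov_le y t : (current_delay t <= size y)%N ->
  \sum_(i < m) (lyapunov c p (arock_step y i t) +
     (d1 * `|delayed_residual y t| ^+ 2 +
      d2 * `|delayed_state y t - nth x0 y 0| ^+ 2)) <=
  m%:R * (`|nth x0 y 0 - p| ^+ 2
     + \sum_(l < size y) c l.+1 * `|nth x0 y l - nth x0 y l.+1| ^+ 2
     + (eta / m%:R + d2 * b) * weighted_gaps y t).
Proof.
move=> ty; set s := delayed_residual y t; set z := delayed_state y t - _.
set D := weighted_gaps y t; set S := \sum_(l < size y) _.
have m0 : 0 < m%:R :> R by rewrite ltr0n.
have sz : 2 * `|s| * `|z| <= `|s| ^+ 2 * b + D by exact: weighted_gaps_ge.
(* The choice a = |z| / b is the optimal one in the Young bound. *)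
have zD : `|z| ^+ 2 <= b * D.
  have zb : 0 <= `|z| / b by rewrite divr_ge0// ltW.
  have /= := weighted_gaps_ge ty zb.
  rewrite -/z -/D => h.
  have -> : `|z| ^+ 2 = b * (2 * (`|z| / b) * `|z| - (`|z| / b) ^+ 2 * b).
    by field; rewrite gt_eqF.
  by rewrite ler_pM2l// lerBlDl.
(* Cocoercivity holds at the delayed state, where the residual is evaluated; passing to the current
   iterate costs |s| |z|. *)
have sv : 2^-1 * `|s| ^+ 2 - `|s| * `|z| <= dot s (nth x0 y 0 - p).
  have -> : nth x0 y 0 - p = (delayed_state y t - p) - z.
    by rewrite opprB [RHS]addrC addrA subrK.
  rewrite (dotBr dot) lerB ?(dot_le_norm dot_norm)//.
  exact: dot_residual_ge.
have -> : \sum_(i < m) (lyapunov c p (arock_step y i t) +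
    (d1 * `|s| ^+ 2 + d2 * `|z| ^+ 2)) =
    \sum_(i < m) `|nth x0 y 0 - eta *: pr i s - p| ^+ 2
    + c 0%N * \sum_(i < m) `|nth x0 y 0 - eta *: pr i s - nth x0 y 0| ^+ 2
    + m%:R * (S + d1 * `|s| ^+ 2 + d2 * `|z| ^+ 2).
  rewrite mulr_sumr -big_split/=.
  have -> : m%:R * (S + d1 * `|s| ^+ 2 + d2 * `|z| ^+ 2) =
      \sum_(i < m) (S + d1 * `|s| ^+ 2 + d2 * `|z| ^+ 2).
    by rewrite sumr_const card_ord mulr_natl.
  rewrite -big_split; apply: eq_bigr => i _ /=.
  by rewrite /lyapunov /= big_ord_recl /= !addrA.
rewrite !(sum_sqr_norm_block_step dot_norm H_blocks) subrr normr0.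
rewrite (linear0r dot) !expr0n /= !mulr0 subr0 add0r.
have szeta : eta * (2 * `|s| * `|z|) <= eta * (`|s| ^+ 2 * b + D).
  by rewrite ler_wpM2l.
have sveta : eta * (2^-1 * `|s| ^+ 2 - `|s| * `|z|) <= eta * dot s (nth x0 y 0 - p).
  by rewrite ler_wpM2l.
have zDd : m%:R * d2 * `|z| ^+ 2 <= m%:R * d2 * (b * D).
  by rewrite ler_wpM2l// mulr_ge0// ltW.
have budget : (m%:R * d1 + eta ^+ 2 * (1 + c 0%N) + eta * b) * `|s| ^+ 2 <=
    eta * `|s| ^+ 2 by rewrite ler_wpM2r ?sqr_ge0.
have -> : m%:R * (`|nth x0 y 0 - p| ^+ 2 + S + (eta / m%:R + d2 * b) * D) =
  m%:R * (`|nth x0 y 0 - p| ^+ 2 + S) + eta * D + m%:R * d2 * (b * D).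
  by field; rewrite gt_eqF.
lra.
Qed.

(** [r] is the law of the delay vector [tau]. After exchanging the sums, the gap at lag [l] carries
    the probability that the delay exceeds [l], which [q l] bounds and [c_decr] absorbs. *)
Lemma lyapunov_descent (W : finType) (r : W -> R) (tau : W -> m.-tuple nat) y :
  (forall w, 0 <= r w) -> \sum_w r w = 1 ->
  (forall l, \sum_(w | (l < current_delay (tau w))%N) r w <= q l) ->
  (forall w, (current_delay (tau w) <= size y)%N) ->
  \sum_w \sum_(i < m) r w / m%:R * (lyapunov c p (arock_step y i (tau w)) +
     (d1 * `|delayed_residual y (tau w)| ^+ 2 +
      d2 * `|delayed_state y (tau w) - nth x0 y 0| ^+ 2)) <= lyapunov c p y.
Proof.
move=> r0 r1 rq tauy; have m0 : 0 < m%:R :> R by rewrite ltr0n.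
set g := eta / m%:R + d2 * b.
have g0 : 0 <= g by rewrite addr_ge0 ?divr_ge0 ?mulr_ge0// ltW.
pose S := \sum_(l < size y) c l.+1 * `|nth x0 y l - nth x0 y l.+1| ^+ 2.
apply: (@le_trans _ _ (\sum_w (r w * (`|nth x0 y 0 - p| ^+ 2 + S) +
    g * (r w * weighted_gaps y (tau w))))).
  apply: ler_sum => w _; rewrite -mulr_sumr.
  apply: (@le_trans _ _ (r w / m%:R * (m%:R * (`|nth x0 y 0 - p| ^+ 2 + S +
      g * weighted_gaps y (tau w))))).
    by rewrite ler_wpM2l ?divr_ge0//; exact: sum_block_lyapunov_le.
  by rewrite le_eqVlt; apply/orP; left; apply/eqP; field; rewrite gt_eqF.
rewrite big_split/= -mulr_suml r1 mul1r -mulr_sumr /lyapunov -addrA lerD2l.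
have -> : \sum_w r w * weighted_gaps y (tau w) = \sum_(l < size y)
    \sum_(w | (l < current_delay (tau w))%N) r w *
      (`|nth x0 y l - nth x0 y l.+1| ^+ 2 / e l).
  rewrite (exchange_big_dep xpredT)//=; apply: eq_bigr => w _.
  by rewrite mulr_sumr.
rewrite mulr_sumr -big_split; apply: ler_sum => l _ /=.
rewrite -mulr_suml.
set G := `|_| ^+ 2; have G0 : 0 <= G by exact: sqr_ge0.
apply: (@le_trans _ _ ((c l.+1 + g * (q l / e l)) * G)); last first.
  by rewrite ler_wpM2r.
rewrite [leRHS]mulrDl lerD2l -mulrA ler_wpM2l//.
have -> : q l / e l * G = q l * (G / e l) by rewrite mulrAC -mulrA.
by rewrite ler_wpM2r// divr_ge0// ltW.
Qed.

End lyapunov.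

(** * Convergence of nonnegative supermartingales *)

Section sigma_algebra_closure.
Variables (T : Type) (G : set (set T)).
Hypothesis G_sigma : sigma_algebra setT G.

Lemma sigma_algebraT : G setT.
Proof. by have [G0 GC _] := G_sigma; rewrite -(setD0 setT); exact: GC. Qed.

Lemma sigma_algebraU A B : G A -> G B -> G (A `|` B).
Proof.
move=> GA GB; have [G0 _ GU] := G_sigma.
rewrite -bigcup2E; apply: GU => -[|[|k]]//=.
Qed.

Lemma sigma_algebraI A B : G A -> G B -> G (A `&` B).
Proof.
move=> GA GB; have [G0 GC _] := G_sigma.
rewrite -[A `&` B]setCK -setTD; apply: (GC _); rewrite setCI.
by apply: sigma_algebraU; rewrite -setTD; exact: GC.
Qed.

End sigma_algebra_closure.

Section real_sequences.
Context {R : realType}.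

Lemma nneseries_fin_cvg (v : nat -> R) : (forall k, 0 <= v k) ->
  (\sum_(0 <= k <oo) (v k)%:E < +oo)%E -> cvgn (series v).
Proof.
move=> v0 voo; apply: nondecreasing_is_cvgn.
  by apply/nondecreasing_seqP => n; rewrite /series/= big_nat_recr//= lerDl.
exists (fine (\sum_(0 <= k <oo) (v k)%:E)%E) => _ [n _ <-].
rewrite -lee_fin fineK; last first.
  by rewrite ge0_fin_numE//; apply: nneseries_ge0 => k _ _; rewrite lee_fin.
rewrite /series/= -sumEFin; apply: nneseries_lim_ge => k _ _.
by rewrite lee_fin.
Qed.

(** The limit is the supremum of the eventual lower bounds, finite by the second hypothesis. For
    rationals a < b just above it, [a] is not an eventual lower bound, so [x] eventually stays below
    [b]. *)
Lemma cvg_of_no_oscillation (x : nat -> R) : (forall k, 0 <= x k) ->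
  ~ (forall b, \forall k \near \oo, b <= x k) ->
  (forall a b : rat, ratr a < ratr b :> R ->
    (\forall k \near \oo, ratr a <= x k) \/ (\forall k \near \oo, x k < ratr b)) ->
  cvgn x.
Proof.
move=> x0 /existsNP[M notM] osc.
pose S := [set r | \forall k \near \oo, r <= x k].
have S_ub r : S r -> r <= M.
  move=> Sr; rewrite leNgt; apply/negP => Mr; apply: notM; near=> k.
  by apply: le_trans (ltW Mr) _; near: k.
have supS : has_sup S.
  by split; [exists 0; exact: nearW|exists M].
apply/cvg_ex; exists (sup S); apply/cvgrPdist_le => e e0.
have [s Ss slt] := sup_adherent e0 supS.
have [a /[!in_itv]/= /andP[la ae]] := @rat_in_itvoo R (sup S) (sup S + e)
  ltac:(by rewrite ltrDl).
have [b /[!in_itv]/= /andP[ab be]] := rat_in_itvoo ae.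
have xb : \forall k \near \oo, x k < ratr b.
  have [Sa|//] := osc _ _ ab; exfalso.
  by move: la; rewrite ltNge => /negP; apply; exact: sup_upper_bound.
near=> k; rewrite distrC ler_distl; apply/andP; split.
  by apply: le_trans (ltW slt) _; near: k.
by apply: le_trans (ltW be); apply: ltW; near: k.
Unshelve. all: end_near. Qed.

End real_sequences.

Lemma ae_forall_countable d (Omega : measurableType d) (R : realType)
    (mu : {measure set Omega -> \bar R}) (I : countType) (Q : I -> Omega -> Prop) :
  (forall i, {ae mu, forall w, Q i w}) -> {ae mu, forall w, forall i, Q i w}.
Proof.
move=> aeQ.
have : {ae mu, forall w, forall n, if @unpickle I n is Some i then Q i w else True}.
  apply: ae_foralln => n; case: (unpickle n) => [i|]; first exact: aeQ.
  exact: filterE.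
by apply: filterS => w h i; have := h (pickle i); rewrite pickleK.
Qed.

Section supermartingale.
Context d {Omega : measurableType d} {R : realType} (P : probability Omega R).
Variables (F : nat -> set (set Omega)) (X V : nat -> Omega -> R).
Hypothesis F_sigma : forall k, sigma_algebra setT (F k).
Hypothesis F_measurable : forall k, F k `<=` measurable.
Hypothesis F_mono : forall k, F k `<=` F k.+1.
Hypothesis X_ge0 : forall k w, 0 <= X k w.
Hypothesis V_ge0 : forall k w, 0 <= V k w.
Hypothesis X_adapted : forall k B, measurable B -> F k (X k @^-1` B).
Hypothesis V_measurable : forall k, measurable_fun setT (V k).
Hypothesis X0_integrable : (\int[P]_w (X 0 w)%:E < +oo)%E.
Hypothesis X_decr : forall k A, F k A ->
  (\int[P]_(w in A) (X k.+1 w + V k w)%:E <= \int[P]_(w in A) (X k w)%:E)%E.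

Let X_measurable k : measurable_fun setT (X k).
Proof. by move=> _ B mB; rewrite setTI; exact: F_measurable (X_adapted _ mB). Qed.

Let F_setT k : F k setT.
Proof. exact: sigma_algebraT. Qed.

Let EX_measurable k A : measurable_fun A (fun w => (X k w)%:E).
Proof. by apply/measurable_EFinP; exact: measurable_funTS. Qed.

Let EV_measurable k A : measurable_fun A (fun w => (V k w)%:E).
Proof. by apply/measurable_EFinP; exact: measurable_funTS. Qed.

Let integral_decr k A : F k A ->
  (\int[P]_(w in A) (X k.+1 w)%:E + \int[P]_(w in A) (V k w)%:E <=
   \int[P]_(w in A) (X k w)%:E)%E.
Proof.
move=> FA; apply: le_trans (X_decr FA).
have mA := F_measurable FA.
by rewrite -ge0_integralD//= => w _; rewrite lee_fin.
Qed.

Let integralX_ge0 k A : (0 <= \int[P]_(w in A) (X k w)%:E)%E.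
Proof. by apply: integral_ge0 => w _; rewrite lee_fin. Qed.

Let integralV_ge0 k A : (0 <= \int[P]_(w in A) (V k w)%:E)%E.
Proof. by apply: integral_ge0 => w _; rewrite lee_fin. Qed.

Let sum_integralV_le n :
  (\int[P]_w (X n w)%:E + \sum_(0 <= k < n) \int[P]_w (V k w)%:E <=
   \int[P]_w (X 0 w)%:E)%E.
Proof.
elim: n => [|n IH]; first by rewrite big_nil adde0.
rewrite big_nat_recr//= (le_trans _ IH)// addeCA addeC leeD2r//.
by rewrite integral_decr.
Qed.

Let integralX_le n : (\int[P]_w (X n w)%:E <= \int[P]_w (X 0 w)%:E)%E.
Proof.
apply: le_trans (sum_integralV_le n); rewrite leeDl//.
by rewrite sume_ge0.
Qed.

(** Telescoping bounds the expected partial sums of [V] by the initial expectation; by monotone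
    convergence the full sum is integrable, hence almost everywhere finite. *)
Lemma supermartingale_summable : {ae P, forall w, cvgn (series (V ^~ w))}.
Proof.
have mV k : measurable_fun setT (fun w => (V k w)%:E) by exact: EV_measurable.
have V0 k w : setT w -> (0 <= (V k w)%:E)%E by rewrite lee_fin.
have int_sum : (\int[P]_w (\sum_(0 <= k <oo) (V k w)%:E) < +oo)%E.
  rewrite integral_nneseries//; apply: le_lt_trans X0_integrable.
  apply: lime_le; first by apply: is_cvg_nneseries.
  apply: nearW => n; apply: le_trans (sum_integralV_le n).
  by rewrite leeDr.
have : P.-integrable setT (fun w => \sum_(0 <= k <oo) (V k w)%:E)%E.
  apply/integrableP; split.
    by apply: (@ge0_emeasurable_sum _ _ _ _ _ xpredT) => [k w _ _|//]; rewrite lee_fin.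
  rewrite (eq_integral (fun w => \sum_(0 <= k <oo) (V k w)%:E)%E)// => w _.
  by rewrite gee0_abs//; apply: nneseries_ge0 => k _ _; rewrite lee_fin.
move/(integrable_ae measurableT); apply: filterS => w /(_ I) fin.
by apply: nneseries_fin_cvg => //; rewrite -ge0_fin_numE//; apply: nneseries_ge0 => k _ _; rewrite lee_fin.
Qed.

Section upcrossing.
Variables a b : R.
Hypothesis (a_ge0 : 0 <= a) (ab : a < b).

(* The stakes of the betting strategy that starts betting when [X] falls below
   [a] and stops when [X] reaches [b]. *)
Fixpoint betting (k : nat) : set Omega :=
  match k with
  | 0 => [set w | X 0 w < a]
  | k.+1 => [set w | X k.+1 w < a] `|` betting k `&` [set w | X k.+1 w < b]
  end.

Let F_lt k r : F k [set w | X k w < r].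
Proof.
rewrite (_ : [set _ | _] = X k @^-1` `]-oo, r[%classic); first exact: X_adapted.
by apply/seteqP; split=> w; rewrite /= in_itv.
Qed.

Let F_betting k : F k (betting k).
Proof.
elim: k => [|k IH] /=; first exact: F_lt.
apply: sigma_algebraU => //; apply: sigma_algebraI => //.
exact: F_mono.
Qed.

Let betting_measurable k : measurable (betting k).
Proof. exact: F_measurable (F_betting k). Qed.

Let integral_betting_fin k : (\int[P]_(w in betting k) (X k w)%:E)%E \is a fin_num.
Proof.
rewrite ge0_fin_numE//; apply: le_lt_trans X0_integrable.
apply: le_trans (integralX_le k); apply: ge0_subset_integral => //.
by move=> w _; rewrite lee_fin.
Qed.

(** A bet that stops at time [k.+1] does so with X >= b, hence yields at least b - a over the level
    [a]; a bet that starts there has X < a. *)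
Let betting_gain k w :
  X k.+1 w * \1_(betting k.+1) w + a * \1_(betting k) w +
    (b - a) * \1_(betting k `\` betting k.+1) w <=
  X k.+1 w * \1_(betting k) w + a * \1_(betting k.+1) w.
Proof.
rewrite !indicE in_setD /= in_setU in_setI.
have memE r : (w \in [set w | X k.+1 w < r]) = (X k.+1 w < r).
  by apply/idP/idP; rewrite inE.
rewrite !memE; case: (w \in betting k) => /=;
  case: (ltP (X k.+1 w) a) => /= Xa; try case: (ltP (X k.+1 w) b) => /= Xb;
  lra.
Qed.

(** The quantity u k - a p k loses at least (b - a) times the probability of a stop at each step. It
    starts at most 0, as X < a on the first stake, and never falls below - a. *)
Let sum_upcrossings_le n :
  ((b - a)%:E * \sum_(0 <= k < n) P (betting k `\` betting k.+1) <= a%:E)%E.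
Proof.
pose u k := fine (\int[P]_(w in betting k) (X k w)%:E)%E.
pose p k := fine (P (betting k)).
pose dl k := fine (P (betting k `\` betting k.+1)).
have dlE k : P (betting k `\` betting k.+1) = (dl k)%:E.
  by rewrite fineK// fin_num_measure//; exact: measurableD.
have pE k : P (betting k) = (p k)%:E by rewrite fineK// fin_num_measure.
have uE k : (\int[P]_(w in betting k) (X k w)%:E)%E = (u k)%:E by rewrite fineK.
have intXE k l : (\int[P]_(w in betting l) (X k w)%:E =
    \int[P]_w (X k w * \1_(betting l) w)%:E)%E.
  rewrite integral_mkcond; apply: eq_integral => w _.
  by rewrite patchE indicE; case: ifP; rewrite ?mulr1 ?mulr0.
have mXI k l : measurable_fun setT (fun w => (X k w * \1_(betting l) w)%:E).
  by apply/measurable_EFinP; apply: measurable_funM => //; exact: measurable_indic.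
have XI0 k l w : (0 <= (X k w * \1_(betting l) w)%:E)%E.
  by rewrite lee_fin mulr_ge0.
have intI A r : 0 <= r -> measurable A ->
    (\int[P]_w (r * \1_A w)%:E = r%:E * P A)%E.
  move=> r0 mA; rewrite (@integralZl_indic _ _ _ P _ measurableT (fun=> A)) => [||//].
    by rewrite integral_indic// setIT.
  by rewrite ltNge r0.
have step k : u k.+1 + a * p k + (b - a) * dl k <= u k + a * p k.+1.
  rewrite -lee_fin !EFinD !EFinM -!uE -!pE -dlE.
  have mD : measurable (betting k `\` betting k.+1) by exact: measurableD.
  have ba0 : 0 <= b - a by rewrite subr_ge0 ltW.
  have F0 (A : set Omega) r w : 0 <= r -> (0 <= (r * \1_A w : R)%:E)%E.
    by move=> r0; rewrite lee_fin mulr_ge0.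
  have mF A r : measurable A -> measurable_fun setT (fun w : Omega => (r * \1_A w : R)%:E).
    move=> mA; apply/measurable_EFinP.
    by apply: measurable_funM; [exact: measurable_cst|exact: measurable_indic].
  apply: (@le_trans _ _ (\int[P]_(w in betting k) (X k.+1 w)%:E + a%:E * P (betting k.+1))%E); last first.
    rewrite leeD2r//; apply: le_trans (integral_decr (F_betting k)).
    by rewrite leeDl.
  rewrite !intXE -!intI// -!ge0_integralD//.
  all: try by move=> w _; rewrite ?adde_ge0 ?F0.
  all: try by repeat apply: emeasurable_funD => //; exact: mF.
  apply: ge0_le_integral => //.
  all: try by move=> w _; rewrite ?adde_ge0 ?F0.
  all: try by repeat apply: emeasurable_funD => //; exact: mF.
  by move=> w _; rewrite -!EFinD lee_fin betting_gain.
have u0 : u 0%N <= a * p 0%N.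
  rewrite -lee_fin EFinM -uE -pE -integral_cst//.
  apply: ge0_le_integral => //.
  - by move=> w _; rewrite lee_fin.
  - by move=> w /= /ltW; rewrite lee_fin.
have telescope : u n + (b - a) * (\sum_(0 <= k < n) dl k) + a * p 0%N <= u 0%N + a * p n.
  elim: n => [|k IH]; first by rewrite big_nil mulr0 addr0.
  by rewrite big_nat_recr//=; have := step k; lra.
have un0 : 0 <= u n by rewrite fine_ge0.
have pn1 : p n <= 1 by rewrite -lee_fin -pE probability_le1.
rewrite (eq_bigr (fun k => (dl k)%:E))// sumEFin -EFinM lee_fin.
have : a * p n <= a by rewrite ler_piMr.
lra.
Qed.

(** By Borel-Cantelli, almost surely only finitely many bets are stopped. From then on either some
    bet runs forever, keeping X below [b], or none is ever placed, keeping X at least [a]. *)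
Lemma upcrossing_ae : {ae P, forall w,
  (\forall k \near \oo, a <= X k w) \/ (\forall k \near \oo, X k w < b)}.
Proof.
have mD k : measurable (betting k `\` betting k.+1) by exact: measurableD.
have sum_lt : (\sum_(0 <= k <oo) P (betting k `\` betting k.+1) < +oo)%E.
  have ba0 : 0 < b - a by rewrite subr_gt0.
  apply: (@le_lt_trans _ _ (a / (b - a))%:E); last exact: ltry.
  apply: lime_le; first by apply: is_cvg_nneseries.
  by apply: nearW => n; rewrite mulrC EFinM lee_pdivlMl//.
exists (lim_sup_set (fun k => betting k `\` betting k.+1)); split.
- apply: bigcap_measurable => //= k _; exact: bigcup_measurable.
- exact: lim_sup_set_cvg0.
move=> w /= nw k _ /=; apply: contrapT => Hk; apply: nw.
have stay l : (k <= l)%N -> betting l w -> betting l.+1 w.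
  move=> kl bl; apply: contrapT => nbl; apply: Hk; exists l => //.
have bettingP l : betting l w -> X l w < b.
  by case: l => [|l] /=; [move/lt_trans; exact|case=> [/lt_trans|[]//]; exact].
have [[l kl bl]|nobet] := pselect (exists2 l, (k <= l)%N & betting l w).
  right; exists l => // j /= lj; apply: bettingP.
  elim: j lj => [|j IH]; first by rewrite leqn0 => /eqP <-.
  rewrite leq_eqVlt => /predU1P[<-//|lj].
  by apply: stay; [exact: leq_trans kl lj|exact: IH].
left; exists k => // j /= kj; rewrite leNgt; apply/negP => Xa; apply: nobet.
by exists j => //; case: j {kj} Xa => //= j Xa; left.
Qed.

End upcrossing.

(** Fatou's lemma makes the limit inferior integrable, which excludes escape to infinity; the
    upcrossing bound for all rational pairs excludes oscillation. *)
Lemma supermartingale_cvg : {ae P, forall w, cvgn (X ^~ w)}.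
Proof.
pose einf w := limn_einf (fun k => (X k w)%:E).
have einf0 w : (0 <= einf w)%E.
  rewrite /einf limn_einf_lim; apply: lime_ge; first exact: is_cvg_einfs.
  by apply: nearW => n; apply: le_ereal_inf_tmp => _ [k _ <-]; rewrite lee_fin.
have no_escape : {ae P, forall w, ~ forall b, \forall k \near \oo, b <= X k w}.
  have int_einf : P.-integrable setT einf.
    apply/integrableP; split.
      apply: (measurableT_comp (f := @oppe R)) => //.
      apply: measurable_fun_limn_esup => k.
      by apply: (measurableT_comp (f := @oppe R)) => //; exact: EX_measurable.
    under eq_integral do rewrite gee0_abs//.
    apply: le_lt_trans X0_integrable.
    apply: le_trans (fatou P measurableT _ _) _ => //.
      by move=> n w _; rewrite lee_fin.
    rewrite limn_einf_lim; apply: lime_le; first exact: is_cvg_einfs.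
    apply: nearW => n; apply: le_trans (integralX_le n).
    by apply: ereal_inf_lbound; exists n => /=.
  move: (integrable_ae measurableT int_einf); apply: filterS => w /(_ I) fin Xoo.
  have : (X k w)%:E @[k --> \oo] --> +oo%E.
    by apply/cvgeyPge => b; apply: filterS (Xoo b) => k; rewrite lee_fin.
  by move/cvg_limn_einf_sup => [einfoo _]; move: fin; rewrite /einf einfoo.
have osc : {ae P, forall w, forall ij : rat * rat, ratr ij.1 < ratr ij.2 :> R ->
    (\forall k \near \oo, ratr ij.1 <= X k w) \/
    (\forall k \near \oo, X k w < ratr ij.2)}.
  apply: ae_forall_countable => -[i j] /=.
  have [i0|i0] := leP 0 (ratr i : R); last first.
    apply: filterE => w _; left; apply: nearW => k.
    exact: le_trans (ltW i0) (X_ge0 k w).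
  have [ij|ij] := ltP (ratr i : R) (ratr j); last exact: filterE.
  by move: (upcrossing_ae i0 ij); apply: filterS => w h _.
move: no_escape osc; apply: filterS2 => w h1 h2.
by apply: cvg_of_no_oscillation => // a b ab; exact: (h2 (a, b)).
Qed.

End supermartingale.

(** * Processes driven by independent finite-valued innovations *)

Lemma integral_finite_valued d (Omega : measurableType d) (R : realType)
    (mu : {measure set Omega -> \bar R}) (V : eqType) (h : Omega -> V)
    (s : seq V) (f : V -> R) (A : set Omega) :
  uniq s -> (forall w, h w \in s) ->
  (forall v, measurable (h @^-1` [set v])) -> (forall v, 0 <= f v) ->
  measurable A ->
  (\int[mu]_(w in A) (f (h w))%:E =
   \sum_(v <- s) (f v)%:E * mu (A `&` h @^-1` [set v]))%E.
Proof.
move=> us hs mh f0 mA.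
pose F v w : R := f v * \1_(h @^-1` [set v]) w.
transitivity (\int[mu]_(w in A) (\sum_(v <- s) (F v w)%:E))%E.
  apply: eq_integral => w _; rewrite sumEFin (bigD1_seq (h w))//= big1 ?addr0.
    by rewrite /F indicE mem_set// mulr1.
  by move=> v vw; rewrite /F indicE memNset ?mulr0//= => /eqP; rewrite eq_sym (negbTE vw).
rewrite ge0_integral_sum//.
- apply: eq_bigr => v _.
  rewrite (@integralZl_indic _ _ _ mu _ mA (fun=> h @^-1` [set v])) => [||//].
    by rewrite integral_indic// setIC.
  by rewrite ltNge f0.
- move=> v; apply/measurable_EFinP; apply: measurable_funM; first exact: measurable_cst.
  exact: measurable_indic.
- by move=> v w _; rewrite lee_fin mulr_ge0.
Qed.

Lemma measure_finite_valued d (Omega : measurableType d) (R : realType)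
    (mu : {measure set Omega -> \bar R}) (V : eqType) (h : Omega -> V)
    (s : seq V) (A : set Omega) :
  uniq s -> (forall w, h w \in s) ->
  (forall v, measurable (h @^-1` [set v])) -> measurable A ->
  mu A = (\sum_(v <- s) mu (A `&` h @^-1` [set v]))%E.
Proof.
move=> us hs mh mA.
have := @integral_finite_valued _ _ _ mu _ h s (fun=> 1) A us hs mh (fun=> ler01) mA.
rewrite integral_cst// mul1e => ->.
by apply: eq_bigr => v _; rewrite mul1e.
Qed.

Section finitely_driven_process.
Context d {Omega : measurableType d} {R : realType} (P : probability Omega R).
(* [Ev k] holds events determined by the k-th innovation; it need not be closed
   under complement or union (below: rectangles). *)
Variable Ev : nat -> set (set Omega).
Hypothesis Ev_measurable : forall k, Ev k `<=` measurable.
Hypothesis Ev_T : forall k, Ev k setT.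
Hypothesis Ev_independent : forall n (A : nat -> set Omega),
  (forall k, Ev k (A k)) ->
  P (\bigcap_(k in `I_n) A k) = (\prod_(k < n) P (A k))%E.
Variables (W : nat -> finType) (g : forall k, Omega -> W k).
Hypothesis g_Ev : forall k a, Ev k (g k @^-1` [set a]).
Variables (S : choiceType) (y0 : S) (phi : forall k, S -> W k -> S).
Variable Y : nat -> Omega -> S.
Hypothesis Y_0 : forall w, Y 0 w = y0.
Hypothesis Y_S : forall k w, Y k.+1 w = phi (Y k w) (g k w).

Let g_measurable k a : measurable (g k @^-1` [set a]).
Proof. exact: Ev_measurable (g_Ev a). Qed.

Lemma process_measurable k B : measurable (Y k @^-1` B).
Proof.
elim: k B => [|k IH] B.
  rewrite (_ : _ @^-1` B = if `[< B y0 >] then setT else set0).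
    by case: asboolP.
  by apply/seteqP; split=> w /=; rewrite Y_0; case: asboolP.
rewrite (_ : _ @^-1` B = \bigcup_(a in [set: W k])
    (Y k @^-1` [set y | B (phi y a)] `&` g k @^-1` [set a])).
  apply: fin_bigcup_measurable => // a _.
  by apply: measurableI => //; exact: IH.
apply/seteqP; split=> w /=; first by rewrite Y_S => Bw; exists (g k w).
by move=> [a _ [/= Bw ga]]; rewrite Y_S ga.
Qed.

Lemma process_step_measurable k (B : set (S * W k)) :
  measurable [set w | B (Y k w, g k w)].
Proof.
rewrite (_ : [set _ | _] = \bigcup_(a in [set: W k])
    (Y k @^-1` [set y | B (y, a)] `&` g k @^-1` [set a])).
  apply: fin_bigcup_measurable => // a _.
  by apply: measurableI => //; exact: process_measurable.
apply/seteqP; split=> w /=; first by move=> Bw; exists (g k w).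
by move=> [a _ [/= Bw ga]]; rewrite ga.
Qed.

Lemma process_finite_range k : exists s : seq S, uniq s /\ forall w, Y k w \in s.
Proof.
elim: k => [|k [s [us sP]]].
  by exists [:: y0]; split=> // w; rewrite Y_0 inE.
exists (undup (allpairs (@phi k) s (index_enum (W k)))).
rewrite undup_uniq; split=> // w; rewrite mem_undup Y_S.
by apply: allpairs_f => //; rewrite mem_index_enum.
Qed.

Let future k n (A : nat -> set Omega) := \bigcap_(j in [set j | k <= j < k + n]%N) A j.

(** Induction on [k] with the length [n] of the future general: splitting by the value [a] of [g k]
    turns an event of [Y k.+1] into one of [Y k], and the event g k = a joins the future as its
    first member. *)
Let process_future_independent k n B A : (forall j, Ev j (A j)) ->
  P (Y k @^-1` B `&` future k n A) =
  (P (Y k @^-1` B) * \prod_(k <= j < k + n) P (A j))%E.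
Proof.
have fut_meas j l A' : (forall i, Ev i (A' i)) -> measurable (future j l A').
  move=> EvA; apply: bigcap_measurableType => i _.
  exact: Ev_measurable (EvA i).
elim: k n B A => [|k IH] n B A EvA.
  rewrite (_ : Y 0 @^-1` B = if `[< B y0 >] then setT else set0); last first.
    by apply/seteqP; split=> w /=; rewrite Y_0; case: asboolP.
  case: asboolP => _; last by rewrite set0I measure0 mul0e.
  by rewrite setTI probability_setT mul1e big_mkord -Ev_independent//.
pose A' a j := if j == k then g k @^-1` [set a] else A j.
have EvA' a j : Ev j (A' a j) by rewrite /A'; case: eqP => // ->.
have splitA a E :
    (Y k.+1 @^-1` B `&` E) `&` g k @^-1` [set a] =
    (Y k @^-1` [set y | B (phi y a)] `&` E) `&` g k @^-1` [set a].
  by apply/seteqP; split=> w /= -[[Bw Ew] ga]; move: Bw; rewrite Y_S ga.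
have gw w : g k w \in index_enum (W k) by rewrite mem_index_enum.
have mY := process_measurable.
have mYf : measurable (Y k.+1 @^-1` B `&` future k.+1 n A).
  by apply: measurableI => //; exact: fut_meas.
have decomp (A0 : set Omega) : measurable A0 ->
    P A0 = (\sum_a P (A0 `&` g k @^-1` [set a]))%E.
  exact: (measure_finite_valued P (index_enum_uniq (W k)) gw (@g_measurable k)).
rewrite (decomp _ mYf) (decomp _ (mY k.+1 B)).
rewrite ge0_sume_distrl//; apply: eq_bigr => a _.
have futS : future k n.+1 (A' a) = g k @^-1` [set a] `&` future k.+1 n A.
  rewrite /future /A'; apply/seteqP; split=> w /= h.
    split=> [|j /= /andP[kj jn]].
      by have := h k; rewrite /= eqxx leqnn addnS ltnS leq_addr; exact.
    have := h j; rewrite /= gtn_eqF//; apply.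
    by rewrite ltnW//= addnS -addSn.
  move=> j /= /andP[kj jn]; case: eqP => [//|/eqP jk]; first by case: h.
  case: h => _; apply => /=; rewrite ltn_neqAle eq_sym jk kj/=.
  by rewrite addSn -addnS.
have fut1 : future k 1 (A' a) = g k @^-1` [set a].
  rewrite /future /A'; apply/seteqP; split=> w /= h.
    by have := h k; rewrite /= eqxx leqnn addn1 ltnSn; exact.
  by move=> j /=; rewrite addn1 ltnS -eqn_leq => /eqP <-; rewrite eqxx.
have := splitA a setT; rewrite !setIT => ->.
rewrite splitA -setIA [future _ _ _ `&` _]setIC -futS.
rewrite IH// -fut1 IH//.
rewrite addn1 big_nat1 big_ltn ?addnS ?ltnS ?leq_addr// muleA.
rewrite {1}/A' eqxx; congr (_ * _)%E; first by rewrite /A' eqxx.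
rewrite addSn; apply: eq_big_nat => j /andP[kj _].
by rewrite /A' gtn_eqF.
Qed.

Lemma process_step_independent k B E : Ev k E ->
  P (Y k @^-1` B `&` E) = (P (Y k @^-1` B) * P E)%E.
Proof.
move=> EvE; pose A j := if j == k then E else setT.
have EvA j : Ev j (A j) by rewrite /A; case: eqP => // ->.
have := @process_future_independent k 1 B A EvA.
rewrite addn1 big_nat1 {2}/A eqxx => <-; congr (P (_ `&` _)).
rewrite /future /A; apply/seteqP; split=> w /= h.
  by move=> j /=; rewrite addn1 ltnS -eqn_leq => /eqP <-; rewrite eqxx.
by have := h k; rewrite /= eqxx leqnn addn1 ltnSn; exact.
Qed.

(** The finite-sum form of conditioning on [Y k]: on each fiber Y k = y the innovation keeps its
    law, so the integral of [f] is the mass of the fiber times an average that [psi y] dominates. *)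
Lemma integral_process_step_le k (f : S -> W k -> R) (psi : S -> R) B :
  (forall y a, 0 <= f y a) -> (forall y, 0 <= psi y) ->
  (forall w, \sum_a fine (P (g k @^-1` [set a])) * f (Y k w) a <= psi (Y k w)) ->
  (\int[P]_(w in Y k @^-1` B) (f (Y k w) (g k w))%:E <=
   \int[P]_(w in Y k @^-1` B) (psi (Y k w))%:E)%E.
Proof.
move=> f0 psi0 fpsi.
have [s [us sP]] := process_finite_range k.
have mYg v : measurable ((fun w => (Y k w, g k w)) @^-1` [set v]).
  rewrite (_ : _ @^-1` _ = Y k @^-1` [set v.1] `&` g k @^-1` [set v.2]).
    by apply: measurableI => //; exact: process_measurable.
  by apply/seteqP; split=> w /=; case: v => y a /=; [move=> [<- <-]|move=> [-> ->]].
rewrite (@integral_finite_valued _ _ _ P _ (fun w => (Y k w, g k w))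
  (allpairs (fun y a => (y, a)) s (index_enum (W k))) (fun v => f v.1 v.2))//.
- rewrite (@integral_finite_valued _ _ _ P _ (Y k) s psi)//; last 2 first.
    by move=> v; exact: process_measurable.
    exact: process_measurable.
  rewrite big_allpairs/=; apply: lee_sum => y ys.
  (* [fpsi] speaks of attained states only; the fiber of any other [y] is empty. *)
  have [[w Yw]|noy] := pselect (exists w, Y k w = y); last first.
    rewrite big1 => [|a _]; first by rewrite mule_ge0// lee_fin.
    rewrite (_ : _ `&` _ = set0) ?measure0 ?mule0//.
    by rewrite -subset0 => w /= [_ [Yw _]]; apply: noy; exists w.
  pose q := fine (P (Y k @^-1` (B `&` [set y]))).
  have qE : P (Y k @^-1` (B `&` [set y])) = q%:E.
    by rewrite fineK// fin_num_measure//; exact: process_measurable.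
  rewrite (eq_bigr (fun a => (fine (P (g k @^-1` [set a])) * f y a * q)%:E)); last first.
    move=> a _; rewrite (_ : _ `&` _ = Y k @^-1` (B `&` [set y]) `&` g k @^-1` [set a]).
      have -> : P (Y k @^-1` (B `&` [set y]) `&` g k @^-1` [set a]) =
          (P (Y k @^-1` (B `&` [set y])) * P (g k @^-1` [set a]))%E.
        exact: process_step_independent.
      rewrite qE -[P (g k @^-1` _)]fineK; last by rewrite fin_num_measure.
      by rewrite -!EFinM; congr EFin; ring.
    by apply/seteqP; split=> w' /=; [move=> [? [<- <-]]|move=> [[? <-] <-]].
  rewrite (_ : _ `&` _ = Y k @^-1` (B `&` [set y]))//.
  have -> : P (Y k @^-1` (B `&` [set y])) = q%:E by [].
  rewrite sumEFin -EFinM lee_fin -mulr_suml ler_wpM2r ?fine_ge0// -Yw.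
  exact: fpsi.
- rewrite allpairs_uniq ?index_enum_uniq//.
  by move=> [y a] [y' a'] _ _ [-> ->].
- by move=> w; apply: allpairs_f => //; rewrite mem_index_enum.
- exact: process_measurable.
Qed.

End finitely_driven_process.

(** * Choice of the weights *)

Section step_size.
Context {R : realType}.

Lemma lyapunov_weights (q theta : nat -> R) (A B M eta : R) :
  (forall l, 0 <= q l) -> (forall l, 0 < theta l) ->
  (forall n, \sum_(l < n) Num.sqrt (q l) * theta l <= A) ->
  (forall n, \sum_(l < n) Num.sqrt (q l) / theta l <= B) ->
  0 < M -> 0 < eta -> eta * (1 + (A + B) / Num.sqrt M) < 1 ->
  exists (e c : nat -> R) (b d1 d2 : R),
    [/\ forall l, 0 < e l, 0 < b & forall n, \sum_(l < n) e l <= b] /\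
    [/\ 0 < d1, 0 < d2, forall l, 0 <= c l,
        forall l, c l.+1 + (eta / M + d2 * b) * (q l / e l) <= c l
      & M * d1 + eta ^+ 2 * (1 + c 0%N) + eta * b <= eta].
Proof.
move=> q0 th0 sumA sumB M0 eta0 eta_lt.
set rM := Num.sqrt M in eta_lt.
have rM0 : 0 < rM by rewrite sqrtr_gt0.
have rM2 : rM * rM = M by rewrite -expr2 sqr_sqrtr// ltW.
have A0 : 0 <= A by have := sumA 0%N; rewrite big_ord0.
have B0 : 0 <= B by have := sumB 0%N; rewrite big_ord0.
(* The slack of the step-size condition, spent in quarters: one each on [b], on [d1] and on [d2],
   with one left over. *)
pose s := 1 - eta * (1 + (A + B) / rM).
have s0 : 0 < s by rewrite subr_gt0.
(* The main term makes both the sum of [e] and the sum of q / e controllable by [A] and [B]; the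
   geometric term, of total at most s / 4, keeps [e l] positive when [q l] is zero. *)
pose e l := eta / rM * (Num.sqrt (q l) * theta l) + s / 4 * 2^-1 ^+ l.+1.
pose b := eta / rM * A + s / 4.
have er0 : 0 < eta / rM by rewrite divr_gt0.
have s40 : 0 < s / 4 by rewrite divr_gt0.
have b0 : 0 < b by rewrite ltr_wpDl// mulr_ge0// ltW.
have main0 l : 0 <= eta / rM * (Num.sqrt (q l) * theta l).
  by rewrite (mulr_ge0 (ltW er0))// (mulr_ge0 (sqrtr_ge0 _))// ltW.
have e0 l : 0 < e l by rewrite ltr_wpDl// mulr_gt0// exprn_gt0.
have sum_e n : \sum_(l < n) e l <= b.
  rewrite big_split/= -!mulr_sumr; apply: lerD.
    exact: ler_wpM2l (ltW er0) _ _ (sumA n).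
  rewrite -[leRHS]mulr1 ler_wpM2l ?(ltW s40)//.
  suff -> : \sum_(l < n) (2^-1 : R) ^+ l.+1 = 1 - 2^-1 ^+ n.
    by rewrite gerBl exprn_ge0.
  elim: n => [|n IH]; first by rewrite big_ord0 expr0 subrr.
  by rewrite big_ord_recr/= IH exprS; field.
pose D l := rM / eta * (Num.sqrt (q l) / theta l).
have qe_le l : q l / e l <= D l.
  rewrite ler_pdivrMr//; apply: (@le_trans _ _ (D l * (eta / rM * (Num.sqrt (q l) * theta l)))).
    rewrite -{1}(sqr_sqrtr (q0 l)) /D expr2 le_eqVlt; apply/orP; left; apply/eqP.
    by field; rewrite !gt_eqF.
  apply: ler_wpM2l.
    by rewrite mulr_ge0 ?(divr_ge0 (ltW rM0) (ltW eta0))// divr_ge0 ?sqrtr_ge0// ltW.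
  by rewrite lerDl mulr_ge0 ?(ltW s40)// exprn_ge0.
pose Db := rM / eta * B.
have re0 : 0 <= rM / eta by rewrite divr_ge0// ltW.
have Db0 : 0 <= Db by rewrite mulr_ge0.
pose d1 := eta * s / (4 * M).
(* [c 0] depends on [d2] through [gamma]; this choice bounds that contribution by s / 4, and the
   added 1 keeps the denominator positive when [B] is zero. *)
pose d2 := s / (4 * (eta * b * Db + 1)).
have den0 : 0 < eta * b * Db + 1 by rewrite ltr_wpDl// mulr_ge0// mulr_ge0// ltW.
have d10 : 0 < d1 by rewrite divr_gt0// mulr_gt0.
have d20 : 0 < d2 by rewrite divr_gt0// mulr_gt0.
pose gamma := eta / M + d2 * b.
have gamma0 : 0 <= gamma.
  exact: ltW (addr_gt0 (divr_gt0 eta0 M0) (mulr_gt0 d20 b0)).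
(* The recurrence c (l + 1) + gamma D l = c l holds exactly, and starting at gamma Db keeps [c]
   nonnegative because [Db] bounds every partial sum of [D]. *)
pose c l := gamma * (Db - \sum_(i < l) D i).
exists e, c, b, d1, d2; split => //; split => //.
- move=> l; rewrite mulr_ge0// subr_ge0 -mulr_sumr.
  by rewrite ler_wpM2l.
- move=> l; rewrite /c big_ord_recr /= -mulrDr ler_wpM2l//.
  by have := qe_le l; lra.
rewrite /c big_ord0 subr0.
have -> : eta ^+ 2 * (1 + gamma * Db) =
    eta ^+ 2 + eta ^+ 2 * B / rM + eta * (d2 * (eta * b * Db)).
  rewrite /gamma mulrDl mulrDr /Db -rM2.
  by field; rewrite !gt_eqF.
have -> : M * d1 = eta * s / 4 by rewrite /d1; field; rewrite gt_eqF.
have d2_le : eta * (d2 * (eta * b * Db)) <= eta * (s / 4).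
  rewrite ler_wpM2l ?(ltW eta0)//.
  rewrite (_ : s / 4 = d2 * (eta * b * Db + 1)); last first.
    by rewrite /d2; field; rewrite gt_eqF.
  by rewrite ler_wpM2l ?lerDl// ltW.
set u := eta * (d2 * _) in d2_le *.
have -> : eta * b = eta ^+ 2 * A / rM + eta * s / 4 by rewrite /b; field; rewrite gt_eqF.
have s_eq : eta * s = eta - (eta ^+ 2 + eta ^+ 2 * B / rM + eta ^+ 2 * A / rM).
  by rewrite /s; field; rewrite gt_eqF.
have := mulr_gt0 eta0 s0; lra.
Qed.

Lemma sum_le_fine_nneseries (v : nat -> R) n : (forall l, 0 <= v l) ->
  (\sum_(1 <= l <oo) (v l)%:E < +oo)%E ->
  \sum_(l < n) v l.+1 <= fine (\sum_(1 <= l <oo) (v l)%:E)%E.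
Proof.
move=> v0 voo; rewrite -lee_fin fineK; last first.
  by rewrite ge0_fin_numE//; apply: nneseries_ge0 => k _ _; rewrite lee_fin.
rewrite -(big_mkord xpredT (fun l => v l.+1)) -(big_add1 _ _ 0 n.+1 xpredT v).
by rewrite -sumEFin; apply: nneseries_lim_ge => k _ _; rewrite lee_fin.
Qed.

Lemma nneseries_fin_dominated (u v : nat -> R) :
  (forall l, 0 <= u l) -> (forall l, 0 <= v l) ->
  (forall l, (1 <= l)%N -> u l <= v l) ->
  (\sum_(1 <= l <oo) (v l)%:E < +oo)%E -> (\sum_(1 <= l <oo) (u l)%:E < +oo)%E.
Proof.
move=> u0 v0 uv; apply: le_lt_trans; apply: lee_lim.
- by apply: is_cvg_nneseries => l _ _; rewrite lee_fin.
- by apply: is_cvg_nneseries => l _ _; rewrite lee_fin.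
apply: nearW => n; rewrite [leLHS]big_nat_cond [leRHS]big_nat_cond.
by apply: lee_sum => l /andP[/andP[l1 _] _]; rewrite lee_fin uv.
Qed.

(** The two conditions are two choices of [theta]: the square root of l + 1 for the first, the
    constant 1 for the second. In both, [h] is exactly the inverse of the last factor, and c < 1
    gives strictness. *)
Lemma step_condition_weights (p : nat -> R) (m : nat) (c h : R) :
  (forall l, 0 <= p l) -> 0 < c -> c < 1 ->
  step_condition1 m.+1 p h \/ step_condition2 m.+1 p h ->
  exists (theta : nat -> R) (A B : R),
    [/\ forall l, 0 < theta l,
        forall n, \sum_(l < n) Num.sqrt (p l.+1) * theta l <= A,
        forall n, \sum_(l < n) Num.sqrt (p l.+1) / theta l <= B,
        0 < c * h & c * h * (1 + (A + B) / Num.sqrt m.+1%:R) < 1].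
Proof.
move=> p0 c0 c1.
have rm0 : 0 < Num.sqrt m.+1%:R :> R by rewrite sqrtr_gt0.
have concl A B : 0 <= A -> 0 <= B -> h = (1 + (A + B) / Num.sqrt m.+1%:R)^-1 ->
    0 < c * h /\ c * h * (1 + (A + B) / Num.sqrt m.+1%:R) < 1.
  move=> A0 B0 ->; have den0 : 0 < 1 + (A + B) / Num.sqrt m.+1%:R.
    by rewrite ltr_wpDr// divr_ge0 ?addr_ge0// ltW.
  by rewrite mulr_gt0 ?invr_gt0// -mulrA mulVf ?gt_eqF// mulr1.
case=> -[fin hE].
- pose v l := Num.sqrt (p l) * Num.sqrt l%:R; pose v' l := Num.sqrt (p l) / Num.sqrt l%:R.
  have v0 l : 0 <= v l by rewrite mulr_ge0 ?sqrtr_ge0.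
  have v'0 l : 0 <= v' l by rewrite divr_ge0 ?sqrtr_ge0.
  have vE l : Num.sqrt (l%:R * p l) = v l by rewrite sqrtrM ?ler0n// mulrC.
  have v'v l : (1 <= l)%N -> v' l <= v l.
    move=> l1; rewrite ler_wpM2l ?sqrtr_ge0//.
    have l1' : 1 <= Num.sqrt l%:R :> R by rewrite -[leLHS]sqrtr1 ler_wsqrtr// ler1n.
    by rewrite (le_trans _ l1')// invf_le1// (lt_le_trans _ l1').
  have vfin : (\sum_(1 <= l <oo) (v l)%:E < +oo)%E.
    by under eq_eseriesr do rewrite -vE.
  have v'fin : (\sum_(1 <= l <oo) (v' l)%:E < +oo)%E.
    exact: nneseries_fin_dominated v'v vfin.
  set A := fine (\sum_(1 <= l <oo) (v l)%:E)%E in concl *.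
  set B := fine (\sum_(1 <= l <oo) (v' l)%:E)%E in concl *.
  exists (fun l => Num.sqrt l.+1%:R), A, B.
  have A0 : 0 <= A by apply: fine_ge0; apply: nneseries_ge0 => l _ _; rewrite lee_fin.
  have B0 : 0 <= B by apply: fine_ge0; apply: nneseries_ge0 => l _ _; rewrite lee_fin.
  have [|ch0 ch1] := concl A B A0 B0.
    rewrite hE mulrC /A /B -fineD ?ge0_fin_numE//; last 2 first.
      by apply: nneseries_ge0 => l _ _; rewrite lee_fin.
      by apply: nneseries_ge0 => l _ _; rewrite lee_fin.
    rewrite -nneseriesD; last 2 first.
      by move=> l _ _; rewrite lee_fin.
      by move=> l _ _; rewrite lee_fin.
    by under eq_eseriesr do rewrite mulrDr.
  split=> //.
  + by move=> n; exact: sum_le_fine_nneseries.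
  + by move=> n; exact: sum_le_fine_nneseries.
- pose v l := Num.sqrt (p l).
  have v0 l : 0 <= v l by rewrite sqrtr_ge0.
  have vfin : (\sum_(1 <= l <oo) (v l)%:E < +oo)%E.
    apply: nneseries_fin_dominated fin => // l l1.
    by rewrite ler_peMr// ler1n.
  set A := fine (\sum_(1 <= l <oo) (v l)%:E)%E in hE *.
  have A0 : 0 <= A by apply: fine_ge0; apply: nneseries_ge0 => l _ _; rewrite lee_fin.
  exists (fun=> 1), A, A.
  have [|ch0 ch1] := concl A A A0 A0.
    by rewrite hE; congr (_^-1); congr (_ + _); rewrite -/A; ring.
  split=> // n.
  + under eq_bigr do rewrite mulr1; exact: (@sum_le_fine_nneseries v).
  + under eq_bigr do rewrite divr1; exact: (@sum_le_fine_nneseries v).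
Qed.

End step_size.

(** * Almost sure convergence *)

(** A dense sequence of the space may miss [F], so for each of its points and each radius 1 / (n +
    1) a point of [F] within that radius is selected when there is one. *)
Lemma separable_fix_seq (R : realType) (H : completeNormedModType R) (F : set H) :
  separable_space H -> F !=set0 ->
  exists pt : nat * nat -> H, (forall ij, F (pt ij)) /\
    forall p e, F p -> 0 < e -> exists ij, `|p - pt ij| < e.
Proof.
move=> [D [cD dD]] [p0 Fp0].
have [f Df] : exists f : nat -> H, D `<=` range f.
  have /pfcard_geP[D0|[f]] := cD.
    by exists (fun=> 0); rewrite D0.
  by exists f => y Dy; have [n _ <-] := 'surj_f Dy; exists n.
have near_pt (ij : nat * nat) : exists p, F p /\
    forall p', F p' -> `|p' - f ij.1| < ij.2.+1%:R^-1 ->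
      `|p - f ij.1| < ij.2.+1%:R^-1.
  have [[p [Fp pf]]|nop] := pselect
      (exists p, F p /\ `|p - f ij.1| < ij.2.+1%:R^-1); first by exists p.
  by exists p0; split=> // p Fp pf; exfalso; apply: nop; exists p.
have [pt ptP] := choice near_pt.
exists pt; split=> [ij|p e Fp e0]; first by have [] := ptP ij.
have e20 : 0 < e / 2 by rewrite divr_gt0.
have [n ne] : exists n, n.+1%:R^-1 < e / 2 :> R.
  have [N _ hN] := near_infty_natSinv_lt (PosNum e20).
  by exists N; exact: (hN N (leqnn N)).
have n0 : 0 < n.+1%:R^-1 :> R by rewrite invr_gt0.
have [|y [py Dy]] := dD (ball p n.+1%:R^-1) _ (ball_open _ _).
  by exists p; exact: ballxx.
have [i _ fi] := Df y Dy.
exists (i, n); have [_ /(_ p Fp)] := ptP (i, n); rewrite /= fi => h.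
rewrite -ball_normE /= in py.
rewrite (le_lt_trans (ler_distD y _ _))// [e]splitr ltrD//.
  exact: lt_trans py ne.
by rewrite distrC (lt_trans (h py)).
Qed.

Section iterates.
Context {H : Type}.

Fixpoint iterates (x : nat -> H) (k : nat) : seq H :=
  match k with
  | 0 => [:: x 0%N]
  | k'.+1 => x k :: iterates x k'
  end.

Lemma size_iterates x k : size (iterates x k) = k.+1.
Proof. by elim: k => //= k ->. Qed.

Lemma nth_iterates x k l : nth (x 0%N) (iterates x k) l = x (k - l)%N.
Proof.
elim: k l => [[|l]|k IH [|l]]//=; by rewrite ?sub0n ?nth_nil ?subSS.
Qed.

End iterates.

(** * Deterministic convergence along a single path *)

Section path_convergence.
Context {R : realType} {H : completeNormedModType R} {m : nat}.
Variable dot : {dot H for idfun}.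
Hypothesis dot_norm : norm_of_dot dot.
Variables (E : 'I_m -> {pred H}) (pr : 'I_m -> H -> H).
Hypothesis H_blocks : orthogonal_blocks dot E pr.
Variable T : H -> H.
Hypothesis T_nonexpansive : nonexpansive T.
Hypothesis T_fixed_point : Fix T !=set0.

Lemma norm_pr_le i (v : H) : `|pr i v| <= `|v|.
Proof. by have := norm_sum_pr_le dot_norm H_blocks (pred1 i) v; rewrite big_pred1_eq. Qed.

Variables (x xhat : nat -> H) (i : nat -> 'I_m) (eta d1 d2 : R) (c : nat -> R).
Hypothesis x_step : forall k,
  x k.+1 = x k - eta *: pr (i k) (xhat k - T (xhat k)).
Hypotheses (d1_gt0 : 0 < d1) (d2_gt0 : 0 < d2).
Let drift k := d1 * `|xhat k - T (xhat k)| ^+ 2 + d2 * `|xhat k - x k| ^+ 2.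
Hypothesis drift_summable : cvgn (series drift).
Hypothesis c_ge0 : forall l, 0 <= c l.
Hypothesis c_nonincr : forall l, c l.+1 <= c l.

Let cvg0_of_drift (v : nat -> H) a : 0 < a ->
  (forall k, a * `|v k| ^+ 2 <= drift k) -> v k @[k --> \oo] --> 0.
Proof.
move=> a0 vd; apply/cvgr0Pnorm_le => e e0; near=> k.
have : `|drift k| <= a * e ^+ 2.
  near: k; move/cvg_series_cvg_0/cvgr0Pnorm_le : drift_summable; apply.
  by rewrite mulr_gt0// exprn_gt0.
move=> /(le_trans (ler_norm _)) /(le_trans (vd k)); rewrite ler_pM2l//.
by rewrite ler_pXn2r ?nnegrE// ltW.
Unshelve. all: end_near. Qed.

Let residual_cvg0 : xhat k - T (xhat k) @[k --> \oo] --> 0.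
Proof.
apply: (cvg0_of_drift d1_gt0) => k.
by rewrite lerDl mulr_ge0 ?sqr_ge0// ltW.
Qed.

Let delay_error_cvg0 : xhat k - x k @[k --> \oo] --> 0.
Proof.
apply: (cvg0_of_drift d2_gt0) => k.
by rewrite lerDr mulr_ge0 ?sqr_ge0// ltW.
Qed.

Lemma path_residual_cvg0 : x k - T (x k) @[k --> \oo] --> 0.
Proof.
apply/cvgr0Pnorm_le => e e0; have e3 : 0 < e / 3 by rewrite divr_gt0.
near=> k.
have h1 : `|xhat k - T (xhat k)| <= e / 3.
  by near: k; move/cvgr0Pnorm_le : residual_cvg0; exact.
have h2 : `|xhat k - x k| <= e / 3.
  by near: k; move/cvgr0Pnorm_le : delay_error_cvg0; exact.
have h3 := T_nonexpansive (xhat k) (x k).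
have := ler_distD (xhat k) (x k) (T (x k)).
have := ler_distD (T (xhat k)) (xhat k) (T (x k)).
by rewrite (distrC (x k) (xhat k)); lra.
Unshelve. all: end_near. Qed.

Let gap k := `|x k.+1 - x k| ^+ 2.

Let gap_summable : cvgn (series gap).
Proof.
have K0 : 0 <= eta ^+ 2 / d1 by rewrite divr_ge0 ?sqr_ge0// ltW.
have drift0 k : 0 <= drift k by rewrite addr_ge0 ?mulr_ge0 ?sqr_ge0// ltW.
apply: (@series_le_cvg _ _ (fun k => eta ^+ 2 / d1 * drift k)).
- by move=> k; exact: sqr_ge0.
- by move=> k; exact: mulr_ge0.
- move=> k; rewrite /gap x_step addrAC subrr add0r normrN normrZ exprMn.
  rewrite real_normK ?num_real// -mulrA ler_wpM2l ?sqr_ge0//.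
  apply: (@le_trans _ _ (`|xhat k - T (xhat k)| ^+ 2)).
    by rewrite lerXn2r ?nnegrE// norm_pr_le.
  by rewrite ler_pdivlMl// lerDl mulr_ge0 ?sqr_ge0// ltW.
rewrite (_ : series _ = (fun n => eta ^+ 2 / d1 * series drift n)).
  by apply: is_cvgMr.
by apply/funext => n; rewrite /series/= mulr_sumr.
Qed.

Let memory k := \sum_(l < k.+1)
  c l * `|nth (x 0%N) (iterates x k) l - nth (x 0%N) (iterates x k) l.+1| ^+ 2.

(* Because [memory k - c 0 * series gap k] is nonincreasing. *)
Let memory_cvg : cvgn memory.
Proof.
pose u k := memory k - c 0%N * series gap k.
have u_cvg : cvgn u.
  apply: nonincreasing_is_cvgn.
    (* The newest gap, of weight [c 0], cancels against the new term of the series; every older gap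
       passes from weight [c l] to [c l.+1]. *)
    apply/nonincreasing_seqP => k; rewrite /u /memory big_ord_recl /=.
    rewrite !nth_iterates/= /series/= big_nat_recr//= mulrDr ?subn0.
    rewrite [X in X <= _](_ : _ = \sum_(l < k.+1) c l.+1 *
      `|nth (x 0%N) (iterates x k) l - nth (x 0%N) (iterates x k) l.+1| ^+ 2 -
      c 0%N * \sum_(0 <= l < k) gap l); last by rewrite /gap /=; ring.
    rewrite lerD2r; apply: ler_sum => l _.
    by rewrite ler_wpM2r// sqr_ge0.
  exists (- (c 0%N * limn (series gap))) => _ [k _ <-].
  rewrite /u lerBrDr; apply: (@le_trans _ _ 0).
    rewrite addrC subr_le0 ler_wpM2l//.
    apply: nondecreasing_cvgn_le => //.
    apply/nondecreasing_seqP => n; rewrite /series/= big_nat_recr//= lerDl.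
    exact: sqr_ge0.
  by apply: sumr_ge0 => l _; rewrite mulr_ge0// sqr_ge0.
rewrite (_ : memory = (fun k => u k + c 0%N * series gap k)).
  by apply: is_cvgD => //; apply: is_cvgMr.
by apply/funext => k; rewrite /u subrK.
Qed.

Variable pt : nat * nat -> H.
Hypothesis pt_dense : forall p e, Fix T p -> 0 < e -> exists ij, `|p - pt ij| < e.
Hypothesis lyapunov_cvg : forall ij,
  cvgn (fun k => lyapunov (x 0%N) c (pt ij) (iterates x k)).

Let dist_pt_cvg ij : cvgn (fun k => `|x k - pt ij|).
Proof.
have sq_cvg : cvgn (fun k => `|x k - pt ij| ^+ 2).
  rewrite (_ : (fun _ => _) = (fun k =>
      lyapunov (x 0%N) c (pt ij) (iterates x k) - memory k)).
    exact: is_cvgB.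
  apply/funext => k; rewrite /lyapunov size_iterates -/(memory k) addrK.
  by rewrite nth_iterates subn0.
apply/cvg_ex; exists (Num.sqrt (limn (fun k => `|x k - pt ij| ^+ 2))).
rewrite (_ : (fun _ => _) = Num.sqrt \o (fun k => `|x k - pt ij| ^+ 2)).
  by apply: continuous_cvg => //; exact: sqrt_continuous.
by apply/funext => k /=; rewrite sqrtr_sqr normr_id.
Qed.

(** The distance to [x k] is 1-Lipschitz in the point, uniformly in [k], so convergence passes from
    the dense sequence to every fixed point by a Cauchy argument. *)
Let sqr_dist_fix_cvg p : Fix T p -> cvgn (fun k => `|x k - p| ^+ 2).
Proof.
move=> Tp; suff dp : cvgn (fun k => `|x k - p|).
  by rewrite (_ : (fun _ => _) = (fun k => `|x k - p| * `|x k - p|)) //; exact: is_cvgM.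
apply: cauchy_cvg; apply/cauchyP => e e0.
have e2 : 0 < e / 2 by rewrite divr_gt0.
have [ij pij] := pt_dense Tp e2.
pose L := limn (fun k => `|x k - pt ij|).
exists L.
suff : \forall k \near \oo, ball L e `|x k - p| by [].
near=> k; rewrite -ball_normE /=.
have h1 : `|L - `|x k - pt ij| | < e / 2.
  by near: k; move/cvgrPdist_lt : (@dist_pt_cvg ij); exact.
have h2 : `| `|x k - pt ij| - `|x k - p| | <= `|p - pt ij|.
  rewrite (le_trans (ler_dist_dist _ _))//.
  by rewrite opprB addrC addrA subrK.
by have := ler_distD `|x k - pt ij| L `|x k - p|; lra.
Unshelve. all: end_near. Qed.

Lemma path_weak_cvg : exists2 z, Fix T z & weak_cvg dot x z.
Proof.
exact: (fejer_weak_cvg dot_norm T_nonexpansive T_fixed_point path_residual_cvg0).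
Qed.

End path_convergence.

Lemma measurable_tuple_nat n (C : set (n.-tuple nat)) : measurable C.
Proof.
have mtnth i j : measurable [set t : n.-tuple nat | tnth t i = j].
  have := @measurable_tnth _ nat n i measurableT [set j] I.
  by rewrite setTI; exact.
have m1 t : measurable [set t : n.-tuple nat].
  rewrite (_ : [set t] = \bigcap_(i in [set: 'I_n]) [set s : n.-tuple nat | tnth s i = tnth t i]).
    by apply: fin_bigcap_measurable.
  apply/seteqP; split=> [s /= -> //|s /= st].
  by apply: eq_from_tnth => i; exact: st.
rewrite (_ : C = \bigcup_k [set t | unpickle k = Some t /\ C t]).
  apply: bigcup_measurable => k _; case: (unpickle k) => [t|]; last first.
    by rewrite (_ : [set _ | _] = set0)//; apply/seteqP; split=> s // -[].
  have [Ct|nCt] := pselect (C t).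
    rewrite (_ : [set _ | _] = [set t])//.
    by apply/seteqP; split=> s /= => [[[->]]|->].
  rewrite (_ : [set _ | _] = set0)//.
  by apply/seteqP; split=> s //= -[[<-]].
apply/seteqP; split=> [t Ct|t [k _ []]//].
by exists (pickle t) => //; rewrite /= pickleK.
Qed.

(** * Joint independence of blocks and delays *)

Section independence.
Context d {Omega : measurableType d} {R : realType} (P : probability Omega R).
Context d1 d2 {U : measurableType d1} {V : measurableType d2}.
Variables (X : nat -> {RV P >-> U}) (Z : nat -> {RV P >-> V}).
Hypotheses (X_indep : mutually_independent X) (Z_indep : mutually_independent Z).
Hypothesis XZ_indep : independent_sequences X Z.

Let sigma_preimage d' (U' : measurableType d') (X' : nat -> {RV P >-> U'}) k A :
  measurable A -> sigma_of_seq X' (X' k @^-1` A).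
Proof.
move=> mA; apply: sub_sigma_algebra; exists k => //=.
by exists A => //; rewrite setTI.
Qed.

Let sigma_bigcap d' (U' : measurableType d') (X' : nat -> {RV P >-> U'}) n
    (A : nat -> set U') : (forall k, measurable (A k)) ->
  sigma_of_seq X' (\bigcap_(k in `I_n) X' k @^-1` A k).
Proof.
move=> mA; rewrite bigcap_mkord.
elim: n => [|n IH]; first by rewrite big_ord0; exact: sigma_algebraT (smallest_sigma_algebra _ _).
rewrite big_ord_recr/=.
have sX : sigma_algebra setT (sigma_of_seq X') by exact: smallest_sigma_algebra.
by apply: (sigma_algebraI sX IH); exact: sigma_preimage.
Qed.

Let mutually_independent_ord d' (U' : measurableType d') (X' : nat -> {RV P >-> U'})
    n (A : nat -> set U') : mutually_independent X' -> (forall k, measurable (A k)) ->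
  P (\bigcap_(k in `I_n) X' k @^-1` A k) = (\prod_(k < n) P (X' k @^-1` A k))%E.
Proof.
move=> indep mA; have := indep (iota 0 n) A (iota_uniq _ _) mA.
rewrite -(big_mkord xpredT (fun k => P (X' k @^-1` A k))) /index_iota subn0 => <-.
by congr (P _); apply: eq_bigcapl; split=> k /=; rewrite mem_iota add0n.
Qed.

Lemma independent_rectangles n (A : nat -> set U) (B : nat -> set V) :
  (forall k, measurable (A k)) -> (forall k, measurable (B k)) ->
  P (\bigcap_(k in `I_n) (X k @^-1` A k `&` Z k @^-1` B k)) =
  (\prod_(k < n) P (X k @^-1` A k `&` Z k @^-1` B k))%E.
Proof.
move=> mA mB.
rewrite (eq_bigr (fun k : 'I_n => P (X k @^-1` A k) * P (Z k @^-1` B k))%E); last first.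
  by move=> k _; apply: XZ_indep; exact: sigma_preimage.
rewrite bigcapI XZ_indep; try exact: sigma_bigcap.
rewrite !mutually_independent_ord//.
by rewrite -big_split.
Qed.

Lemma independent_pair k (A : set U) (B : set V) : measurable A -> measurable B ->
  P (X k @^-1` A `&` Z k @^-1` B) = (P (X k @^-1` A) * P (Z k @^-1` B))%E.
Proof. by move=> mA mB; apply: XZ_indep; exact: sigma_preimage. Qed.

End independence.

Section clipping.
Variables (n k : nat).

(** Makes the innovation of step [k] finite-valued. [inord] never meets its default, since the
    minimum is at most [k]. *)
Definition clip (t : n.-tuple nat) : n.-tuple 'I_k.+1 :=
  map_tuple (fun j => inord (minn j k)) t.

Definition unclip (t : n.-tuple 'I_k.+1) : n.-tuple nat :=
  map_tuple (@nat_of_ord _) t.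

Lemma tnth_clip t i : tnth (unclip (clip t)) i = minn (tnth t i) k.
Proof. by rewrite !tnth_map inordK// ltnS geq_minr. Qed.

Lemma current_delay_unclip t : (current_delay (unclip t) <= k)%N.
Proof. by apply/bigmax_leqP => i _; rewrite tnth_map -ltnS. Qed.

Lemma current_delay_clip t : (current_delay (unclip (clip t)) <= current_delay t)%N.
Proof.
apply/bigmax_leqP => i _; rewrite tnth_clip geq_min.
by rewrite leq_current_delay.
Qed.

End clipping.

Section arock_path.
Context {R : realType} {H : completeNormedModType R} {m : nat}.
Variable dot : {dot H for idfun}.
Hypothesis dot_norm : norm_of_dot dot.
Variables (E : 'I_m -> {pred H}) (pr : 'I_m -> H -> H).
Hypothesis H_blocks : orthogonal_blocks dot E pr.
Variables (T : H -> H) (eta : R) (b : nat -> 'I_m) (j : nat -> m.-tuple nat).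
Variables (x0 : H) (x : nat -> H).
Hypothesis x_ARock : ARock pr T (fun=> eta) b j x0 x.

Lemma ARock_step k (xhat := delayed_iterate pr x k (j k)) :
  x k.+1 = x k - eta *: pr (b k) (xhat - T xhat).
Proof.
have [_ step] := x_ARock.
rewrite -(sum_pr H_blocks (x k.+1)) -[in RHS](sum_pr H_blocks (x k)).
rewrite (bigD1 (b k))//= [in RHS](bigD1 (b k))//= step eqxx -/xhat.
rewrite addrAC; congr (_ + _ - _).
by apply: eq_bigr => i ib; rewrite step (negbTE ib).
Qed.

(** Clipping is harmless: a delay above [k] and the delay [k] both select x^0. *)
Lemma delayed_state_iterates k :
  delayed_state pr x0 (iterates x k) (unclip (clip k (j k))) =
  delayed_iterate pr x k (j k).
Proof.
have [<- _] := x_ARock; apply: eq_bigr => i _.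
rewrite nth_iterates tnth_clip /minn; case: ltnP => // kt.
by rewrite subnn (eqP kt).
Qed.

Lemma iterates_step k :
  iterates x k.+1 = arock_step pr T x0 eta (iterates x k) (b k) (unclip (clip k (j k))).
Proof.
rewrite /arock_step /delayed_residual delayed_state_iterates /= ARock_step.
by have [<- _] := x_ARock; rewrite nth_iterates subn0.
Qed.

End arock_path.

(* The number of blocks is m.+1, an arbitrary positive integer. *)
Theorem theorem1 (R : realType) (H : completeNormedModType R)
  (dot : {dot H for idfun}) (m : nat)
  (E : 'I_m.+1 -> {pred H}) (pr : 'I_m.+1 -> H -> H) (T : H -> H)
  (d : measure_display) (Omega : measurableType d) (P : probability Omega R)
  (I : nat -> {RV P >-> 'I_m.+1}) (J : nat -> {RV P >-> m.+1.-tuple nat})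
  (x0 : H) (x : nat -> Omega -> H) (c h : R)
  (dot_norm : norm_of_dot dot)
  (H_separable : separable_space H)
  (H_blocks : orthogonal_blocks dot E pr)
  (T_nonexpansive : nonexpansive T)
  (T_fixed_point : Fix T !=set0)
  (I_iid : iid I)
  (I_uniform : forall k, uniform_block (I k))
  (J_iid : iid J)
  (J_evenly_old : evenly_old J)
  (IJ_independent : independent_sequences I J)
  (c_gt0 : 0 < c) (c_lt1 : c < 1)
  (h_step : step_condition1 m.+1 (delay_tail J) h \/
            step_condition2 m.+1 (delay_tail J) h)
  (x_ARock : forall w : Omega,
     ARock pr T (fun=> c * h) (fun k => I k w) (fun k => J k w) x0 (x^~ w)) :
  {ae P, forall w : Omega, exists2 z, Fix T z & weak_cvg dot (x^~ w) z}.
Proof.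
pose eta := c * h.
(* A delay exceeds [l] exactly when it is at least l + 1. *)
pose q l := delay_tail J l.+1.
have p_ge0 l : 0 <= delay_tail J l by exact: fine_ge0.
have [theta [A [B [theta0 sumA sumB eta0 eta_lt]]]] :=
  step_condition_weights p_ge0 c_gt0 c_lt1 h_step.
have M0 : 0 < m.+1%:R :> R by rewrite ltr0n.
have [e [cw [b [d1 [d2 [[e0 b0 sum_e] [d10 d20 cw0 cw_decr budget]]]]]]] :=
  lyapunov_weights (fun l => p_ge0 l.+1) theta0 sumA sumB M0 eta0 eta_lt.
have [I_indep I_same] := I_iid.
have [J_indep J_same] := J_iid.
have mI (D : set 'I_m.+1) : measurable D by [].
pose Ev k (A' : set Omega) := exists (D : set 'I_m.+1) (C : set (m.+1.-tuple nat)),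
  A' = I k @^-1` D `&` J k @^-1` C.
have Ev_meas k : Ev k `<=` measurable.
  move=> _ [D [C ->]]; apply: measurableI.
    by rewrite -[_ @^-1` _]setTI; apply: measurable_funPT.
  rewrite -[_ @^-1` _]setTI; apply: measurable_funPT => //.
  exact: measurable_tuple_nat.
have Ev_T k : Ev k setT by exists setT, setT; rewrite !preimage_setT setTI.
have Ev_indep n (A' : nat -> set Omega) : (forall k, Ev k (A' k)) ->
    P (\bigcap_(k in `I_n) A' k) = (\prod_(k < n) P (A' k))%E.
  move=> /choice[D] /choice[C] A'E.
  rewrite (eq_bigr (fun k : 'I_n => P (I k @^-1` D k `&` J k @^-1` C k))); last first.
    by move=> k _; rewrite -A'E.
  rewrite -(independent_rectangles I_indep J_indep IJ_independent n (fun k => mI (D k)) (fun k => measurable_tuple_nat (C k))).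
  by congr (P _); apply: eq_bigcapr => k _; rewrite A'E.
pose W k := ('I_m.+1 * m.+1.-tuple 'I_k.+1)%type : finType.
pose g k w : W k := (I k w, clip k (J k w)).
have g_Ev k a : Ev k (g k @^-1` [set a]).
  case: a => i t; exists [set i], [set s | clip k s = t].
  by apply/seteqP; split=> w; rewrite /g/= => -[<- <-].
pose phi k (y : seq H) (a : W k) := arock_step pr T x0 eta y a.1 (unclip a.2).
pose Y k w := iterates (x^~ w) k.
have Y0 w : Y 0%N w = [:: x0] by rewrite /Y /=; have [-> _] := x_ARock w.
have YS k w : Y k.+1 w = phi k (Y k w) (g k w) by exact: (iterates_step H_blocks (x_ARock w) k).
(* The events determined by the history up to step [k]. Arbitrary [Bs] are allowed: [Y k] has finite
   range with measurable fibers. *)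
pose F k (A' : set Omega) := exists Bs : set (seq H), A' = Y k @^-1` Bs.
have Y_meas k Bs : measurable (Y k @^-1` Bs).
  exact: (process_measurable Ev_meas g_Ev Y0 YS).
have F_sigma k : sigma_algebra setT (F k).
  split.
  - by exists set0; rewrite preimage_set0.
  - by move=> _ [Bs ->]; exists (~` Bs); rewrite setTD.
  - move=> A' /choice[Bs A'E]; exists (\bigcup_n Bs n).
    by rewrite preimage_bigcup; apply: eq_bigcupr => n _; exact: A'E.
have F_meas k : F k `<=` measurable by move=> _ [Bs ->]; exact: Y_meas.
(* The state stores all past iterates, so [behead] recovers the previous state. *)
have F_mono k : F k `<=` F k.+1.
  by move=> _ [Bs ->]; exists [set y | Bs (behead y)].
pose V k w := d1 * `|delayed_residual pr T x0 (Y k w) (unclip (g k w).2)| ^+ 2 +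
  d2 * `|delayed_state pr x0 (Y k w) (unclip (g k w).2) - nth x0 (Y k w) 0| ^+ 2.
have V0 k w : 0 <= V k w by rewrite addr_ge0 ?mulr_ge0 ?sqr_ge0// ltW.
have V_meas k : measurable_fun setT (V k).
  move=> _ Bs mBs; rewrite setTI.
  exact: (process_step_measurable Ev_meas g_Ev Y0 YS (k := k)
    (fun ya => Bs (d1 * `|delayed_residual pr T x0 ya.1 (unclip ya.2.2)| ^+ 2 +
      d2 * `|delayed_state pr x0 ya.1 (unclip ya.2.2) - nth x0 ya.1 0| ^+ 2))).
have lyap0 p y : 0 <= lyapunov x0 cw p y.
  by rewrite addr_ge0 ?sqr_ge0// sumr_ge0// => l _; rewrite mulr_ge0 ?sqr_ge0.
have J_meas k (C : set (m.+1.-tuple nat)) : measurable (J k @^-1` C).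
  rewrite -[_ @^-1` _]setTI; apply: measurable_funPT => //.
  exact: measurable_tuple_nat.
have weight k (i : 'I_m.+1) (t : m.+1.-tuple 'I_k.+1) :
    fine (P (g k @^-1` [set (i, t)])) =
    m.+1%:R^-1 * fine (P (J k @^-1` [set s | clip k s = t])).
  rewrite (_ : _ @^-1` _ = I k @^-1` [set i] `&` J k @^-1` [set s | clip k s = t]).
    have -> : P (I k @^-1` [set i] `&` J k @^-1` [set s | clip k s = t]) =
        (P (I k @^-1` [set i]) * P (J k @^-1` [set s | clip k s = t]))%E.
      exact: (independent_pair IJ_independent k (mI _) (measurable_tuple_nat _)).
    by rewrite I_uniform fineM// fin_num_measure//; exact: J_meas.
  by apply/seteqP; split=> w; rewrite /g/= => -[<- <-].
have descent p k w : Fix T p ->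
    \sum_(a : W k) fine (P (g k @^-1` [set a])) *
      (lyapunov x0 cw p (phi k (Y k w) a) +
       (d1 * `|delayed_residual pr T x0 (Y k w) (unclip a.2)| ^+ 2 +
        d2 * `|delayed_state pr x0 (Y k w) (unclip a.2) - nth x0 (Y k w) 0| ^+ 2)) <=
    lyapunov x0 cw p (Y k w).
  move=> Tp; pose r (t : m.+1.-tuple 'I_k.+1) :=
    fine (P (J k @^-1` [set s | clip k s = t])).
  have fiber_sum (C : set (m.+1.-tuple nat)) : P (J k @^-1` C) =
      (\sum_(t : m.+1.-tuple 'I_k.+1) P (J k @^-1` (C `&` [set s | clip k s = t])))%E.
    refine (@measure_finite_valued _ _ _ P _ (fun w => clip k (J k w)) _ _ (index_enum_uniq _) _ _ _).
    - by move=> w'; rewrite mem_index_enum.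
    - by move=> t; exact: (J_meas k [set s | clip k s = t]).
    - exact: J_meas.
  have rE t : P (J k @^-1` [set s | clip k s = t]) = (r t)%:E.
    by rewrite fineK// fin_num_measure.
  have r1 : \sum_t r t = 1.
    have := fiber_sum setT; rewrite preimage_setT probability_setT.
    rewrite (eq_bigr (fun t => (r t)%:E)); last by move=> t _; rewrite setTI -rE.
    by rewrite sumEFin => -[<-].
  (* Clipping can only lower the current delay, and identical distribution moves the tail from index
     [k] to index 0. *)
  have rq l : \sum_(t | (l < current_delay (unclip t))%N) r t <= q l.
    rewrite /q /delay_tail -lee_fin fineK ?fin_num_measure//; last first.
      exact: (J_meas 0%N [set s | (l < current_delay s)%N]).
    have := J_same k [set s | (l < current_delay s)%N] (measurable_tuple_nat _).
    rewrite /distribution /pushforward /= => <-.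
    have -> := fiber_sum [set s | (l < current_delay s)%N].
    rewrite -sumEFin big_mkcond; apply: lee_sum => t _.
    case: ifPn => [lt|_]; last exact: measure_ge0.
    rewrite -rE le_measure ?inE//.
    move=> w' /= Jt; split=> //; apply: leq_trans (current_delay_clip k (J k w')).
    by rewrite Jt.
  apply: le_trans (lyapunov_descent dot_norm H_blocks T_nonexpansive x0 (ltW eta0)
    e0 b0 sum_e (ltW d20) (ltn0Sn m) budget cw_decr Tp (tau := @unclip m.+1 k)
    (y := Y k w) _ r1 rq _).
  - rewrite exchange_big pair_bigA /= le_eqVlt; apply/orP; left; apply/eqP.
    by apply: eq_bigr => -[i t] _; rewrite weight [_^-1 * _]mulrC.
  - by move=> t; exact: fine_ge0.
  - move=> t; rewrite size_iterates; apply: leqW; exact: current_delay_unclip.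
have X_decr p k A' : Fix T p -> F k A' ->
    (\int[P]_(w in A') (lyapunov x0 cw p (Y k.+1 w) + V k w)%:E <=
     \int[P]_(w in A') (lyapunov x0 cw p (Y k w))%:E)%E.
  move=> Tp [Bs ->].
  have := @integral_process_step_le _ _ _ P _ Ev_meas Ev_T Ev_indep _ _ g_Ev _ _ _ _ Y0 YS k
    (fun y a => lyapunov x0 cw p (phi k y a) +
       (d1 * `|delayed_residual pr T x0 y (unclip a.2)| ^+ 2 +
        d2 * `|delayed_state pr x0 y (unclip a.2) - nth x0 y 0| ^+ 2))
    (lyapunov x0 cw p) Bs _ _ (fun w => descent p k w Tp).
  under [X in _ -> (X <= _)%E]eq_integral do rewrite YS.
  by apply => // y a; rewrite addr_ge0// addr_ge0// mulr_ge0 ?sqr_ge0// ltW.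
have X_adapted p k Bs : F k ((fun w => lyapunov x0 cw p (Y k w)) @^-1` Bs).
  by exists [set y | Bs (lyapunov x0 cw p y)].
have X0_int p : (\int[P]_w (lyapunov x0 cw p (Y 0%N w))%:E < +oo)%E.
  under eq_integral do rewrite Y0.
  rewrite integral_cst//; apply: le_lt_trans (ltry (lyapunov x0 cw p [:: x0])).
  rewrite -[leRHS]mule1; apply: lee_wpmul2l; first by rewrite lee_fin.
  exact: probability_le1.
have ae_cvg p : Fix T p -> {ae P, forall w, cvgn (fun k => lyapunov x0 cw p (Y k w))}.
  move=> Tp; apply: (supermartingale_cvg (X := fun k w => lyapunov x0 cw p (Y k w)) F_sigma F_meas F_mono _ V0 _ V_meas (X0_int p)) => //.
  by move=> k A'; exact: X_decr.
have [p0 Tp0] := T_fixed_point.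
have ae_sum : {ae P, forall w, cvgn (series (V ^~ w))}.
  apply: (supermartingale_summable (X := fun k w => lyapunov x0 cw p0 (Y k w)) F_sigma F_meas _ V0 _ V_meas (X0_int p0)) => //.
  by move=> k A'; exact: X_decr.
(* The exceptional null set depends on the fixed point; a countable dense family of fixed points
   permits a common one. *)
have [pt [Fpt pt_dense]] := separable_fix_seq H_separable T_fixed_point.
have ae_pt : {ae P, forall w, forall ij, cvgn (fun k => lyapunov x0 cw (pt ij) (Y k w))}.
  by apply: ae_forall_countable => ij; exact: ae_cvg.
move: ae_sum ae_pt; apply: filterS2 => w sumV cvgX.
have [x_0 _] := x_ARock w.
apply: (@path_weak_cvg _ _ _ _ dot_norm _ _ H_blocks _ T_nonexpansive T_fixed_point
  (x^~ w) (fun k => delayed_iterate pr (x^~ w) k (J k w)) (fun k => I k w) eta d1 d2 cw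
  (ARock_step H_blocks (x_ARock w)) d10 d20 _ cw0 _ pt pt_dense).
- rewrite (_ : (fun k => _) = V ^~ w)//; apply/funext => k.
  have x_nth : nth x0 (Y k w) 0 = x k w by rewrite -x_0 nth_iterates subn0.
  by rewrite /V x_nth /delayed_residual (delayed_state_iterates (x_ARock w)).
- move=> l; apply: le_trans (cw_decr l); rewrite lerDl.
  apply: mulr_ge0; last by rewrite divr_ge0// ltW.
  exact: ltW (addr_gt0 (divr_gt0 eta0 M0) (mulr_gt0 d20 b0)).
- by move=> ij; rewrite x_0; exact: cvgX.
Qed.
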